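(* Let $(X,\mathfrak{B}_X,\mu)$ be a probability space, where $X$ is a compact metric space, $\mathfrak{B}_X$ its Borel $\sigma$-algebra and $\mu$ a probability measure. Consider the measure-preserving flow $\boldsymbol{S}^t:X\to X$ ($t\in\mathbb{R}$) associated with $$\left.\frac{d\boldsymbol{S}^t(\boldsymbol{x})}{dt}\right|_{t=0}=\boldsymbol{F}(\boldsymbol{x})\quad\text{for each } \boldsymbol{x}\in X,$$ where $\boldsymbol{F}:X\to \mathrm{T}X$ (tangent bundle of $X$) is a nonlinear vector field. Let $S$ be a countable dense subset of $\mathcal{C}(X)$, and let $$\zeta_{\mathrm{e}}=\bigvee_{f\in S}\zeta_f$$ be the product of the measurable partitions $\zeta_f$ of $X$ induced by every $f\in S$. Then $\zeta_{\mathrm{e}}$ is the ergodic partition of $X$ (under the flow $\boldsymbol{S}^t$).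
   Context: A measure-preserving flow is a one-parameter group of diffeomorphisms $\boldsymbol{S}^t:X\to X$, $t\in\mathbb{R}$, with $\mu(\boldsymbol{S}^{-t}(A))=\mu(A)$ for all $A\in\mathfrak{B}_X$, $\boldsymbol{S}^0$ the identity, and $\boldsymbol{S}^{t_1+t_2}=\boldsymbol{S}^{t_1}\circ\boldsymbol{S}^{t_2}$. $\mathcal{C}(X)$ is the space of real-valued continuous functions on $X$ with the sup norm; $\mathcal{L}^1_\mu(X)$ is the space of $\mu$-integrable functions. Time-average: $f^\ast(\boldsymbol{x}):=\lim_{T\to\infty}\frac1T\int_0^T f(\boldsymbol{S}^t(\boldsymbol{x}))\,dt$ where the limit exists. $\mathit{\Sigma}$ is the set of points $\boldsymbol{x}\in X$ such that $f^\ast(\boldsymbol{x})$ exists for all $f\in\mathcal{C}(X)$ (its complement has $\mu$-measure zero). Partition: a partition of $X$ is a family $\zeta$ of sets such that $\mu(A\cap B)=0$ for (distinct) $A,B\in\zeta$ and $\mu(X\setminus\bigcup_{A\in\zeta}A)=0$. The element of $\zeta$ containing $\boldsymbol{x}$ is denoted $\zeta(\boldsymbol{x})$. A partition $\zeta$ is measurable if there is a countable family $\mathfrak{D}=\{D_i\}$ of measurable sets such that every $D_i$ is a union of elements of $\zeta$ and for any pair $A_1,A_2$ of (distinct) elements of $\zeta$ there is $D_j\in\mathfrak{D}$ with $A_1\subset D_j$ and $A_2\subset D_j^{\mathrm c}$ (the complement in $X$). Partition induced by $f$: for $f\in\mathcal{C}(X)$, $\zeta_f$ is the family of level sets $A_\alpha=\{\boldsymbol{x}\in\mathit{\Sigma}: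 f^\ast(\boldsymbol{x})=\alpha\}$, $\alpha\in\mathbb{R}$; it is a measurable partition of $X$. Product: for partitions $\zeta_1,\dots,\zeta_N$, $\bigvee_{n=1}^N\zeta_n$ is the partition whose elements are the sets $\bigcap_{i=1}^N A_i$, $A_i\in\zeta_i$, with $\mu(\bigcap_{i=1}^N A_i)\ne0$. For a countable sequence of partitions, $\bigvee_{n=1}^\infty\zeta_n$ denotes the $\sigma$-algebra generated by $\bigcup_{n=1}^\infty\zeta_n$. Ergodic partition: a measurable partition $\zeta$ of $X$ is ergodic under $\boldsymbol{S}^t$ if for any element $A$ of $\zeta$: (i) $A$ is invariant under $\boldsymbol{S}^t$; and (ii) there exists an invariant probability measure $\mu_A$ on $A$ such that the restriction $\boldsymbol{S}^t|_A$ is an ergodic diffeomorphism on $A$, and for all $f\in\mathcal{L}^1_\mu(X)$, $$\int_X f\,d\mu=\int_X\left[\int_{A=\zeta(\boldsymbol{x})} f|_A\,d\mu_A\right]d\mu(\boldsymbol{x}),$$ where $f|_A$ is the restriction of $f$ to $A$.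
   Formalization: Condition (ii), the existence of an ergodic invariant measure on each element, is proved after removing elements whose union is μ-negligible, since null elements may carry no invariant measure; measurability of the partition and invariance hold for all elements. *)

(* Defs.v *)
From HB Require Import structures.
From mathcomp Require Import all_boot all_order all_algebra.
From mathcomp Require Import all_classical all_reals all_analysis.
Set Implicit Arguments.
Unset Strict Implicit.
Unset Printing Implicit Defensive.
Import Order.TTheory GRing.Theory Num.Theory.
Import numFieldNormedType.Exports.
Local Open Scope classical_set_scope.
Local Open Scope ring_scope.

(* Generated sigma-algebras are only measurable types over pointed types. *)
#[short(type="pmetricType")]
HB.structure Definition PointedMetric (R : numDomainType) :=
  { T of Metric R T & Pointed T }.

Notation borel X := (g_sigma_algebraType (@open X)).

Section Smooth.
Variables (R : realType) (X : pmetricType R).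
Implicit Types (C : set (X -> R)) (phi psi : X -> R) (g : X -> X).

(* The differentiable structure on X that gives a meaning to TX and to
   "diffeomorphism" is represented by its algebra of smooth real functions.
   Only the properties below are required, so that closed manifolds (with C the
   C^k functions, k >= 1 or k = infinity), manifolds with boundary or corners,
   and compact subsets of R^n (restrictions of smooth functions) are all
   instances.  On a compact X, an algebra of continuous functions separating
   the points induces the topology of X. *)
Record smooth_structure C : Prop := SmoothStructure {
  smooth_continuous : forall phi, C phi -> continuous phi ;
  smooth_cst : forall a : R, C (cst a) ;
  smooth_add : forall phi psi, C phi -> C psi -> C (phi \+ psi) ;
  smooth_mul : forall phi psi, C phi -> C psi -> C (phi \* psi) ;
  smooth_separates : forall x y, x <> y -> exists2 phi, C phi & phi x <> phi y
}.

(* T_x X as the derivations at x; only the values of a tangent vector on C are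
   meaningful. *)
Record tangent C (x : X) := Tangent {
  tangent_fun :> (X -> R) -> R ;
  tangent_linear : forall (a : R) phi psi, C phi -> C psi ->
    tangent_fun (a \*o phi \+ psi) = a * tangent_fun phi + tangent_fun psi ;
  tangent_leibniz : forall phi psi, C phi -> C psi ->
    tangent_fun (phi \* psi) = phi x * tangent_fun psi + tangent_fun phi * psi x
}.

Definition diffeomorphism C g :=
  exists h : X -> X, [/\ cancel g h, cancel h g &
    forall phi, C phi -> C (phi \o g) /\ C (phi \o h)].

(* dS^t(x)/dt at t = 0 is the tangent vector F(x). *)
Definition generated_by C (S : R -> X -> X) (F : forall x, tangent C x) :=
  forall x phi, C phi ->
    is_derive (0 : R) (1 : R) (fun t => phi (S t x)) (F x phi).

End Smooth.

Section Ergodic.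
Variables (R : realType) (X : pmetricType R).
Implicit Types (S : R -> X -> X) (f : X -> R) (x : X) (A B : set X)
  (zeta : set (set X)).

(* In a flow, S^{-t}(B) is the preimage of B under S^t. *)
Definition preserves S (mu : set X -> \bar R) :=
  forall (t : R) (B : set (borel X)),
    measurable B -> mu (S t @^-1` B) = mu B.

Record measure_preserving_flow (C : set (X -> R)) (mu : set X -> \bar R) S
  : Prop := MeasurePreservingFlow {
  flow_diffeo : forall t, diffeomorphism C (S t) ;
  flow0 : S 0 = id ;
  flowD : forall t1 t2, S (t1 + t2) = S t1 \o S t2 ;
  flow_preserves : preserves S mu
}.

Definition average S f x (T : R) : R :=
  T^-1 * \int[lebesgue_measure]_(t in `[0, T]) f (S t x).

Definition time_average S f x : R := lim (average S f x T @[T --> +oo]).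

Definition regular_points S : set X :=
  [set x | forall f, continuous f -> cvg (average S f x T @[T --> +oo])].

Definition sup_norm f : R := sup (range (fun x => `|f x|)).

Definition dense_in_continuous (D : set (X -> R)) :=
  D `<=` [set f | continuous f] /\
  forall f, continuous f -> forall e : R, 0 < e ->
    exists2 g, D g & sup_norm (f \- g) < e.

(* Negligibility (rather than measure zero) because the sets need not be Borel
   a priori. *)
Definition partition_of (mu : set (borel X) -> \bar R) zeta :=
  (forall A B, zeta A -> zeta B -> A <> B -> mu.-negligible (A `&` B)) /\
  mu.-negligible (~` \bigcup_(A in zeta) A).

Definition measurable_partition (mu : set (borel X) -> \bar R) zeta :=
  partition_of mu zeta /\
  exists DD : set (set (borel X)),
    [/\ countable DD,
        forall D, DD D -> measurable D,
        forall D, DD D -> exists2 z, z `<=` zeta & D = \bigcup_(A in z) A &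
        forall A1 A2, zeta A1 -> zeta A2 -> A1 <> A2 ->
          exists D, [/\ DD D, A1 `<=` D & A2 `<=` ~` D]].

(* The element of zeta containing x, and set0 if there is none. *)
Definition element zeta x : set X := xget set0 [set A | zeta A /\ A x].

Definition induced_partition S f : set (set X) :=
  [set [set x | regular_points S x /\ time_average S f x = a] | a in setT].

(* The countable product is a sigma-algebra; as a partition of X, it is the
   family of its atoms. *)
Definition countable_product I (D : set I) (zetas : I -> set (set X))
  : set (set X) := <<s \bigcup_(i in D) zetas i >>.

Definition atoms (F : set (set X)) : set (set X) :=
  [set [set y | forall B, F B -> (B x <-> B y)] | x in setT].

Definition invariant S A := forall t, S t @` A = A.

(* Ergodicity of the flow on A: the invariant sets are those of the whole
   flow. *)
Definition ergodic_on S A (nu : set (borel X) -> \bar R) :=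
  forall B : set (borel X), measurable B -> B `<=` A -> invariant S B ->
    nu B = 0%E \/ nu B = 1%E.

(* A family of invariant probability measures mu_A on A (i.e., concentrated
   on A), for A in zeta, that are ergodic and disintegrate mu.  The first two
   items of the last conjunction say that the iterated integral of the third is
   meaningful. *)
Definition ergodic_decomposition (mu : probability (borel X) R) S zeta :=
  exists m : set X -> probability (borel X) R,
    (forall A, zeta A ->
      [/\ measurable (A : set (borel X)), m A A = 1%E, preserves S (m A) &
          ergodic_on S A (m A)]) /\
    (forall f : borel X -> R, mu.-integrable setT (EFin \o f) ->
      let inner x := (\int[m (element zeta x)]_(y in element zeta x)
                        (f y)%:E)%E in
      [/\ {ae mu, forall x, (m (element zeta x)).-integrable
                              (element zeta x) (EFin \o f)},
          mu.-integrable setT inner &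
          (\int[mu]_x (f x)%:E = \int[mu]_x inner x)%E]).

Definition ergodic_partition (mu : probability (borel X) R) S zeta :=
  [/\ measurable_partition mu zeta,
      forall A, zeta A -> invariant S A &
      ergodic_decomposition mu S zeta].

(* zeta is an ergodic partition, partitions being identified when they differ
   by the removal of elements with negligible union.  This is needed for
   products of the partitions induced by time averages: for the flow of
     theta' = (sin theta)^2 + (sin u)^2,   u' = - (sin u)^3
   on the torus and mu the Dirac measure at (0, 0), the points (theta, u) with
   sin u != 0 have time averages (f(0, 0) + f(pi, 0)) / 2 and form a negligible
   atom carrying no invariant probability measure.  The invariance of the
   elements holds without exception. *)
Definition ergodic_partition_mod0 (mu : probability (borel X) R) S zeta :=
  [/\ measurable_partition mu zeta,
      forall A, zeta A -> invariant S A &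
      exists2 zeta', zeta' `<=` zeta & ergodic_partition mu S zeta'].

End Ergodic.

(* Main.v *)
Require Import Defs.
From HB Require Import structures.
From mathcomp Require Import all_boot all_order all_algebra.
From mathcomp Require Import all_classical all_reals all_analysis.
From mathcomp Require Import measurable_realfun giry ring lra.
Set Implicit Arguments.
Unset Strict Implicit.
Unset Printing Implicit Defensive.
Import Order.TTheory GRing.Theory Num.Theory.
Import numFieldNormedType.Exports.
Local Open Scope classical_set_scope.
Local Open Scope ring_scope.

(**
  Write [A f x] for the time average of [f] at a regular point [x]. The map
  [f |-> A f x] is a normalized positive functional on the continuous functions,
  so Riesz' theorem gives a probability [k x] whose integrals are the time
  averages at [x]; it is invariant because [A f] is constant on orbits. By
  Birkhoff's theorem, regular points have full measure for every invariant
  probability, and [A f] and [f] have the same integral; a monotone class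
  argument turns this into the disintegration of [mu] by [k]. Therefore the
  variance of [A f] under [k x], which is [\int (A f)^2 d(k x) - (A f x)^2], has
  integral [0] in [x]: for almost every [x], [k x] is concentrated on the atom of
  [x]. For such [x], if [B] is an invariant subset of the atom, then
  [\int_B f d(k x) = (k x)(B) * \int f d(k x)] for all continuous [f], hence for
  [f = \1_B], so that [(k x)(B)] is its own square.
*)

(** Riesz' theorem determines [k x] on continuous functions only, while the variance involves the
    square of [A f], which is merely Borel; this is why the disintegration is needed for all bounded
    Borel functions. Quantifying over all continuous functions would produce uncountable
    intersections, so regularity, atoms and zero variance are all tested on the countable set [D],
    and uniform approximation recovers the other functions. Birkhoff's theorem concerns a single
    map: it is applied to the time-one map, the observable being the integral of [f] over one unit
    of time, and boundedness of [f] bridges integer and real times. Irregular points, if any, form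
    one atom, and an atom of regular points may fail to carry its own [k x]. The union of all these
    exceptional atoms is negligible; they stay in the full partition and are discarded only for the
    disintegration. *)

Lemma indic_le1 (T : Type) (R : realType) (A : set T) (x : T) : `|\1_A x : R| <= 1.
Proof. by rewrite indicE; case: (_ \in _); rewrite ?normr0 ?normr1. Qed.

(** * Real-valued integrals of bounded functions *)

Section BoundedFunctions.
Context {d : measure_display} {T : measurableType d} {R : realType}.
Variable P : {measure set T -> \bar R}.
Implicit Types (f g : T -> R) (A D : set T) (M : R).

Lemma bounded_integrable D f M : measurable D -> (P D < +oo)%E ->
  measurable_fun D f -> (forall x, D x -> `|f x| <= M) ->
  P.-integrable D (EFin \o f).
Proof.
move=> mD PD mf fM; apply: measurable_bounded_integrable => //.
exists M; split; first exact: num_real.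
by move=> a Ma x Dx /=; rewrite (le_trans (fM x Dx))// ltW.
Qed.

Lemma EFin_Rintegral D f : measurable D -> P.-integrable D (EFin \o f) ->
  (\int[P]_(x in D) f x)%:E = (\int[P]_(x in D) (f x)%:E)%E.
Proof. by move=> mD fi; rewrite fineK//; exact: integrable_fin_num. Qed.

Lemma Rintegral_indic A : measurable A -> \int[P]_x (\1_A x : R) = fine (P A).
Proof. by move=> mA; rewrite /Rintegral integral_indic// setIT. Qed.

Lemma bounded_convergence D (F : nat -> T -> R) f M : measurable D ->
  (P D < +oo)%E -> (forall n, measurable_fun D (F n)) ->
  (forall n x, D x -> `|F n x| <= M) ->
  (forall x, D x -> F n x @[n --> \oo] --> f x) ->
  \int[P]_(x in D) F n x @[n --> \oo] --> \int[P]_(x in D) f x.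
Proof.
move=> mD PD mF FM Ff.
have mf : measurable_fun D f by exact: (measurable_fun_cvg mF).
have [] := @dominated_convergence _ T R P D mD (fun n => EFin \o F n) (EFin \o f) (cst M%:E).
- by move=> n; exact/measurable_EFinP.
- exact/measurable_EFinP.
- apply: aeW => x Dx; apply: cvg_EFin; first exact: nearW.
  exact: Ff.
- by apply: (@bounded_integrable D (cst M) `|M|).
- by apply: aeW => x n Dx /=; rewrite lee_fin FM.
move=> fi _ cv.
by rewrite -EFin_Rintegral// in cv; exact: fine_cvg cv.
Qed.

Lemma Rintegral_le_bound D f M : measurable D -> (P D < +oo)%E -> measurable_fun D f ->
  (forall x, D x -> `|f x| <= M) -> `|\int[P]_(x in D) f x| <= M * fine (P D).
Proof.
move=> mD PD mf fM; have fi := bounded_integrable mD PD mf fM.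
rewrite (le_trans (le_normr_Rintegral _ _))// -Rintegral_cst//.
apply: le_Rintegral => //; first exact: integrable_norm.
by apply: (@bounded_integrable _ _ `|M|).
Qed.

End BoundedFunctions.

Section Probability.
Context {d : measure_display} {T : measurableType d} {R : realType}.
Variable P : probability T R.

Lemma probability_lty (D : set T) : measurable D -> (P D < +oo)%E.
Proof. by move=> mD; rewrite (le_lt_trans (probability_le1 _ _))// ltry. Qed.

Lemma Rintegral_cst_probability (r : R) : \int[P]_x r = r.
Proof. by rewrite Rintegral_cst// [X in fine X](probability_setT P) mulr1. Qed.

End Probability.

(** * Continuous functions and Borel sets *)

Section ContinuousFunctions.
Variables (R : realType) (X : pmetricType R).
Implicit Types (f g : X -> R) (U : set X).

Lemma continuous_addf f g : continuous f -> continuous g -> continuous (fun x => f x + g x).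
Proof. by move=> cf cg x; apply: continuousD; [exact: cf|exact: cg]. Qed.

Lemma continuous_mulf f g : continuous f -> continuous g -> continuous (fun x => f x * g x).
Proof. by move=> cf cg x; apply: continuousM; [exact: cf|exact: cg]. Qed.

Lemma continuous_cstf (a : R) : continuous (fun _ : X => a).
Proof. by move=> x; exact: cst_continuous. Qed.

Lemma continuous_scalef a f : continuous f -> continuous (fun x => a * f x).
Proof. by move=> cf; apply: continuous_mulf => //; exact: continuous_cstf. Qed.

Lemma continuous_oppf f : continuous f -> continuous (fun x => - f x).
Proof. by move=> cf x; apply: continuousN; exact: cf. Qed.

Lemma continuous_subf f g : continuous f -> continuous g -> continuous (fun x => f x - g x).
Proof. by move=> cf cg; apply: continuous_addf => //; exact: continuous_oppf. Qed.

Lemma continuous_minf f g : continuous f -> continuous g ->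
  continuous (fun x => Num.min (f x) (g x)).
Proof. by move=> cf cg x; apply: (@continuous_min R X); [exact: cf|exact: cg]. Qed.

Lemma continuous_sumf (F : nat -> X -> R) n : (forall k, continuous (F k)) ->
  continuous (fun x => \sum_(k < n) F k x).
Proof.
move=> cF; elim: n => [|n IH].
  rewrite (_ : (fun x => _) = fun=> 0); first exact: continuous_cstf.
  by apply/funext => x; rewrite big_ord0.
rewrite (_ : (fun x => _) = fun x => \sum_(k < n) F k x + F n x).
  exact: continuous_addf.
by apply/funext => x; rewrite big_ord_recr.
Qed.

Lemma continuous_bounded f : compact [set: X] -> continuous f ->
  exists2 M, 0 < M & forall x, `|f x| <= M.
Proof.
move=> Xc cf.
have cfX : compact (f @` setT).
  by apply: continuous_compact => //; exact: continuous_subspaceT.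
have [M [_ fM]] := compact_bounded cfX.
exists (`|M| + 1); first by rewrite ltr_wpDl.
move=> x; apply: fM; last by exists x.
by rewrite (le_lt_trans (ler_norm _))// ltrDl.
Qed.

Lemma open_borel U : open U -> measurable (U : set (borel X)).
Proof. by move=> oU; exact: sub_sigma_algebra. Qed.

Lemma continuous_borel f : continuous f -> measurable_fun [set: borel X] f.
Proof.
move=> cf; apply: (measurability _ (RGenOInfty.measurableE R)) => // _ [_ [a ->] <-].
rewrite setTI; apply: open_borel.
by move/continuousP: cf; apply; exact: interval_open.
Qed.

Lemma continuous_comp_borel (s : X -> X) : continuous s ->
  measurable_fun [set: borel X] (s : borel X -> borel X).
Proof.
move=> /continuousP cs.
apply: (@measurability _ _ (borel X) (borel X) setT s (@open X)) => //
  _ [A oA <-].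
by rewrite setTI; apply: open_borel; exact: cs.
Qed.

(** The witness is the distance to the complement of [U], truncated at [1]. Putting [1] into the set
    [E x] performs the truncation and keeps the set nonempty when [U] is the whole space. *)
Lemma open_bump U : open U -> exists f, [/\ continuous f,
  forall x, 0 <= f x <= 1 & forall x, U x <-> 0 < f x].
Proof.
move=> oU.
pose E x := [set r : R | r = 1 \/ exists2 y, ~ U y & r = mdist x y].
have E1 x : E x 1 by left.
have E0 x : lbound (E x) 0 by move=> r [->//|[y _ ->]]; exact: mdist_ge0.
have hE x : has_inf (E x) by split; [exists 1|exists 0].
have infle x r : E x r -> inf (E x) <= r by move=> Er; apply: ge_inf => //; case: (hE x).
have lip x z : inf (E x) <= inf (E z) + mdist x z.
  rewrite -lerBlDr; apply: lb_le_inf; first by exists 1.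
  move=> r [->|[y Uy ->]].
    by rewrite lerBlDr (le_trans (infle _ _ (E1 x)))// lerDl mdist_ge0.
  rewrite lerBlDr addrC (le_trans _ (metric_triangle _ _ _))//.
  by apply: infle; right; exists y.
exists (fun x => inf (E x)); split.
- move=> x; apply/cvgrPdist_lt => e e0.
  near=> z.
  have : ball x e z by near: z; exact: nbhsx_ballx.
  rewrite ballEmdist/= => xze; apply: le_lt_trans xze.
  have := lip z x; have := lip x z; rewrite [mdist z x]metric_sym ler_norml.
  by move=> ? ?; apply/andP; split; lra.
- by move=> x; rewrite infle// andbT; apply: lb_le_inf; [exists 1|exact: E0].
- move=> x; split.
    move=> Ux; have /nbhs_ballP[e /= e0 eU] : nbhs x U by exact: open_nbhs_nbhs.
    apply: (@lt_le_trans _ _ (Num.min 1 e)); first by rewrite lt_min ltr01.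
    apply: lb_le_inf; first by exists 1.
    move=> r [->|[y Uy ->]]; first by rewrite ge_min lexx.
    rewrite ge_min; apply/orP; right; rewrite leNgt; apply/negP => xye.
    by apply: Uy; apply: eU; rewrite ballEmdist.
  apply: contraPP => nUx; apply/negP; rewrite -leNgt.
  by apply: infle; right; exists x => //; rewrite mdistxx.
Unshelve. all: by end_near. Qed.

Lemma compact_increasing_cover (V : nat -> set X) : compact [set: X] ->
  (forall n, open (V n)) -> (forall m n, (m <= n)%N -> V m `<=` V n) ->
  (forall x, exists n, V n x) -> exists n, forall x, V n x.
Proof.
rewrite compact_cover => Xc oV mV cV.
have [//||D _ DV] := Xc nat setT V.
  by move=> x _; have [n Vn] := cV x; exists n.
exists (\max_(i <- finmap.enum_fset D) i)%N => x.
have [//|i /= iD Vi] := DV x.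
by apply: mV Vi; exact: leq_bigmax_seq.
Qed.

End ContinuousFunctions.

(** * The Riesz representation theorem *)

Section Riesz.
Variables (R : realType) (X : pmetricType R).
Implicit Types (f g : X -> R) (U V A : set X) (a e : R).
Hypothesis Xc : compact [set: X].
Variable L : (X -> R) -> R.
Hypothesis LD : forall f g, continuous f -> continuous g ->
  L (fun x => f x + g x) = L f + L g.
Hypothesis LZ : forall a f, continuous f -> L (fun x => a * f x) = a * L f.
Hypothesis L_ge0 : forall f, continuous f -> (forall x, 0 <= f x) -> 0 <= L f.
Hypothesis L1 : L (fun=> 1) = 1.

Let LB f g : continuous f -> continuous g -> L (fun x => f x - g x) = L f - L g.
Proof.
move=> cf cg; rewrite -mulN1r -LZ// -LD//; last exact: continuous_scalef.
by congr L; apply/funext => x; rewrite mulN1r.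
Qed.

Let L_le f g : continuous f -> continuous g -> (forall x, f x <= g x) -> L f <= L g.
Proof.
move=> cf cg fg; rewrite -subr_ge0 -LB//; apply: L_ge0 => [|x].
  exact: continuous_subf.
by rewrite subr_ge0.
Qed.

Let Lcst a : L (fun=> a) = a.
Proof.
rewrite -[RHS]mulr1 -L1 -LZ; last exact: continuous_cstf.
by congr L; apply/funext => x; rewrite mulr1.
Qed.

(** The usual condition is that the support lies in [U]. Vanishing outside [U] gives the same
    supremum of [L]: the positive part of [f - e] is within [e] of [f] and is supported in the
    compact set where [f >= e]. *)
Definition riesz_below U := [set f : X -> R | [/\ continuous f, forall x, 0 <= f x <= 1 &
  forall x, ~ U x -> f x = 0]].
Definition riesz_content U := sup (L @` riesz_below U).
Definition riesz_outer A : \bar R :=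
  ereal_inf [set (riesz_content U)%:E | U in [set U | open U /\ A `<=` U]].
Local Notation below := riesz_below.
Local Notation lam := riesz_content.
Local Notation om := riesz_outer.

Let below0 U : below U (fun=> 0).
Proof. by split => // [|x]; [exact: continuous_cstf|rewrite lexx ler01]. Qed.

Let below_le1 U f : below U f -> L f <= 1.
Proof.
case=> cf f01 _; rewrite -L1; apply: L_le => // [|x]; first exact: continuous_cstf.
by case/andP: (f01 x).
Qed.

Let lam_ub U f : below U f -> L f <= lam U.
Proof.
move=> bf; apply: ub_le_sup; last by exists f.
by exists 1 => _ [g bg <-]; exact: below_le1 bg.
Qed.

Let lam_le U a : (forall f, below U f -> L f <= a) -> lam U <= a.
Proof.
move=> La; apply: ge_sup; first by exists (L (fun=> 0)); exists (fun=> 0).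
by move=> _ [f bf <-]; exact: La.
Qed.

Let lam_ge0 U : 0 <= lam U.
Proof. by rewrite -{1}(Lcst 0); apply: lam_ub. Qed.

Let lam_le1 U : lam U <= 1.
Proof. by apply: lam_le => f; exact: below_le1. Qed.

Let lamT : lam setT = 1.
Proof.
apply/eqP; rewrite eq_le lam_le1/= -[leLHS](Lcst 1); apply: lam_ub.
by split => [|x|x /(_ I)//]; [exact: continuous_cstf|rewrite lexx ler01].
Qed.

Let le_lam U V : U `<=` V -> lam U <= lam V.
Proof.
move=> UV; apply: lam_le => f [cf f01 fU]; apply: lam_ub; split => // x nVx.
by apply: fU => /UV.
Qed.

Let lam0 : lam set0 = 0.
Proof.
apply/eqP; rewrite eq_le lam_ge0 andbT; apply: lam_le => f [cf f01 f0].
rewrite (_ : f = fun=> 0) ?Lcst//; apply/funext => x; exact: f0.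
Qed.

(* Dini: [min f (N * \sum_(n < N) phi_n)] converges to [f] uniformly, and its
   successive increments in the number of summands live on the [U n]. *)
Let lam_bigcup (U : nat -> set X) f e : (forall n, open (U n)) ->
  below (\bigcup_n U n) f -> 0 < e ->
  exists N, L f <= \sum_(n < N) lam (U n) + e.
Proof.
move=> oU [cf f01 fU] e0.
have /choice[phi phiP] : forall n, exists g : X -> R, [/\ continuous g,
  forall x, 0 <= g x <= 1 & forall x, U n x <-> 0 < g x].
  by move=> n; exact: open_bump.
have phi_ge0 n x : 0 <= phi n x by have [_ /(_ x)/andP[]] := phiP n.
pose s k x := \sum_(m < k) phi m x.
have cs k : continuous (s k) by apply: continuous_sumf => m; have [] := phiP m.
have s_ge0 k x : 0 <= s k x by apply: sumr_ge0.
have sS k x : s k.+1 x = s k x + phi k x by rewrite /s big_ord_recr.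
pose h N k x := Num.min (f x) (N%:R * s k x).
have ch N k : continuous (h N k).
  by apply: continuous_minf => //; apply: continuous_scalef.
have le_s k l x : (k <= l)%N -> s k x <= s l x.
  move=> /subnKC <-; elim: (l - k)%N => [|n IH]; first by rewrite addn0.
  by rewrite addnS sS (le_trans IH)// lerDl.
have [||x|N fN] := @compact_increasing_cover R X
    (fun N => [set x | f x - N%:R * s N x < e]) Xc.
- move=> N; rewrite (_ : mkset _ =
    (fun x => f x - N%:R * s N x) @^-1` `]-oo, e[%classic); last first.
    by apply/seteqP; split => x /=; rewrite in_itv.
  have : continuous (fun x => f x - N%:R * s N x).
    by apply: continuous_subf => //; apply: continuous_scalef.
  by move=> /continuousP; apply; exact: interval_open.
- move=> m n mn x /=; apply: le_lt_trans; rewrite lerB//.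
  by apply: ler_pM => //; [rewrite ler_nat|exact: le_s].
- have [[n _ Un]|nU] := pselect ((\bigcup_n U n) x); last first.
    by exists 0%N => /=; rewrite fU// mul0r subr0.
  have phin0 : 0 < phi n x by have [_ _ /(_ x)[+ _]] := phiP n; apply.
  (* The index exceeds [n], so that [phi n] is a summand of [s K], and it exceeds the inverse of
     [phi n x], so that [K%:R * s K x >= 1 >= f x]. *)
  pose K := (maxn n.+1 (Num.truncn (phi n x)^-1).+1)%N.
  exists K => /=; apply: (@le_lt_trans _ _ 0) => //.
  rewrite subr_le0; have /andP[_ f1] := f01 x.
  apply: (le_trans f1); apply: (@le_trans _ _ ((phi n x)^-1 * phi n x)).
    by rewrite mulVf// gt_eqF.
  apply: ler_pM => //; first by rewrite invr_ge0 ltW.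
    apply: (@le_trans _ _ (Num.truncn (phi n x)^-1).+1%:R).
      by rewrite ltW// truncnS_gt.
    by rewrite ler_nat leq_maxr.
  apply: (@le_trans _ _ (s n.+1 x)); first by rewrite sS lerDr.
  by apply: le_s; rewrite leq_maxl.
exists N; apply: (@le_trans _ _ (L (h N N) + e)).
  rewrite -[X in _ + X]Lcst -LD//; last exact: continuous_cstf.
  apply: L_le => // [|x]; first by apply: continuous_addf => //; exact: continuous_cstf.
  rewrite /h; have := fN x; rewrite /= => fNx.
  by rewrite addr_minl le_min; apply/andP; split; lra.
rewrite lerD2r.
suff H k : L (h N k) <= \sum_(n < k) lam (U n) by exact: H.
elim: k => [|k IH].
  rewrite big_ord0 (_ : h N 0%N = fun=> 0) ?Lcst//; apply/funext => x.
  rewrite /h /s big_ord0 mulr0; apply/min_idPr; by case/andP: (f01 x).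
rewrite big_ord_recr/= -lerBlDl.
apply: (@le_trans _ _ (L (h N k.+1) - L (h N k))); first by rewrite lerB.
rewrite -LB//; apply: lam_ub; split; first exact: continuous_subf.
  move=> x; have /andP[f0 f1] := f01 x.
  have : N%:R * s k x <= N%:R * s k.+1 x by rewrite ler_wpM2l// le_s.
  have : 0 <= N%:R * s k x by rewrite mulr_ge0.
  rewrite /h; move: (N%:R * s k x) (N%:R * s k.+1 x) => a b a0 ab.
  by rewrite /Num.min; case: ifPn; case: ifPn; rewrite -?leNgt => ? ?;
    apply/andP; split; lra.
move=> x nUx; have [_ /(_ x)/andP[p0 _] /(_ x)[_ pU]] := phiP k.
rewrite /h sS (_ : phi k x = 0) ?addr0 ?subrr//.
by apply/eqP; rewrite eq_le p0 andbT leNgt; apply/negP => /pU.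
Qed.

Let om_ub A U : open U -> A `<=` U -> (om A <= (lam U)%:E)%E.
Proof. by move=> oU AU; apply: ereal_inf_lbound; exists U. Qed.

Let om_ge0 A : (0 <= om A)%E.
Proof. by apply: le_ereal_inf_tmp => _ [U _ <-]; rewrite lee_fin. Qed.

Let om_fin A : om A \is a fin_num.
Proof.
rewrite ge0_fin_numE//; apply: (@le_lt_trans _ _ (lam setT)%:E); last exact: ltry.
by apply: om_ub => //; exact: openT.
Qed.

Let om_adherent A e : 0 < e ->
  exists U, [/\ open U, A `<=` U & ((lam U)%:E <= om A + e%:E)%E].
Proof.
move=> e0; have [_ [U [oU AU] <-] /ltW lU] := lb_ereal_inf_adherent e0 (om_fin A).
by exists U.
Qed.

Let le_om : {homo om : A B / A `<=` B >-> (A <= B)%E}.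
Proof.
move=> A B AB; apply: le_ereal_inf_tmp => _ [U [oU BU] <-].
by apply: om_ub => //; exact: subset_trans BU.
Qed.

Let om_open U : open U -> om U = (lam U)%:E.
Proof.
move=> oU; apply/eqP; rewrite eq_le om_ub//=.
by apply: le_ereal_inf_tmp => _ [V [oV UV] <-]; rewrite lee_fin le_lam.
Qed.

Let om0 : om set0 = 0%E.
Proof. by rewrite om_open ?lam0//; exact: open0. Qed.

Let om_sigma_subadditive : sigma_subadditive om.
Proof.
move=> A; apply/lee_addgt0Pr => e e0.
apply: (le_trans _ (epsilon_trick _ _ (ltW e0))) => //.
have /choice[U UP] : forall n, exists U, [/\ open U, A n `<=` U &
    ((lam U)%:E <= om (A n) + (e / (2 ^ n.+1)%:R)%:E)%E].
  by move=> n; apply: om_adherent; rewrite divr_gt0// ltr0n expn_gt0.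
apply: (@le_trans _ _ (\sum_(n <oo) (lam (U n))%:E)%E); last first.
  by apply: lee_nneseries => n *; [rewrite lee_fin|have [] := UP n].
apply: (@le_trans _ _ (lam (\bigcup_n U n))%:E).
  apply: om_ub; first by apply: bigcup_open => n _; have [] := UP n.
  by apply: subset_bigcup => n _; have [] := UP n.
(* A second margin, because [lam_bigcup] compares [L f] with a finite sum only up to an error. *)
apply/lee_addgt0Pr => c c0.
have partial N : ((\sum_(n < N) lam (U n))%:E <= \sum_(n <oo) (lam (U n))%:E)%E.
  rewrite -sumEFin -(big_mkord xpredT (fun n => (lam (U n))%:E)).
  by apply: nneseries_lim_ge => n *; rewrite lee_fin.
have : (0 <= \sum_(n <oo) (lam (U n))%:E)%E.
  by apply: nneseries_ge0 => n *; rewrite lee_fin.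
(* The series may be infinite, in which case the bound is trivial; otherwise its value [r] dominates
   every partial sum. *)
move: (\sum_(n <oo) (lam (U n))%:E)%E partial => -[r| |]// partial _; last first.
  by rewrite leey.
rewrite -EFinD lee_fin; apply: lam_le => f bf.
have [|N LN] := lam_bigcup _ bf c0; first by move=> n; have [] := UP n.
by rewrite (le_trans LN)// lerD2r -lee_fin.
Qed.

HB.instance Definition _ := isOuterMeasure.Build R X om om0 om_ge0 le_om
  om_sigma_subadditive.

(** The part of [V] outside [U] is not open, but a function [f] below [V] and [U] provides an open
    neighbourhood of it, namely [W], the part of [V] where [f < e]. Functions living on [W] can be
    added to [f] lowered by [e] without exceeding [1], which makes the content almost additive. *)
Let caratheodory_open U : open U -> om.-caratheodory U.
Proof.
move=> oU; apply: le_caratheodory_measurable => A.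
apply: le_ereal_inf_tmp => _ [V [oV AV] <-].
apply: (@le_trans _ _ (om (V `&` U) + om (V `&` ~` U))%E).
  by apply: leeD; apply: le_om; exact: setSI.
rewrite om_open; last exact: openI.
have oE := fineK (om_fin (V `&` ~` U)); rewrite -oE -EFinD lee_fin.
rewrite -lerBrDr; apply: lam_le => f [cf f01 fU].
apply/ler_addgt0Pl => e e0.
pose W := V `&` (f @^-1` `]-oo, e[%classic).
have oW : open W.
  by apply: openI => //; move/continuousP: cf; apply; exact: interval_open.
have : (om (V `&` ~` U) <= (lam W)%:E)%E.
  apply: om_ub => // x [Vx nUx]; split => //=.
  by rewrite in_itv/= fU//; case.
rewrite -oE lee_fin => oleW.
suff : lam W <= lam V + e - L f by move=> ?; lra.
apply: lam_le => g [cg g01 gW].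
(* The first difference is the positive part of [f - e]. It vanishes where [f <= e], and [g]
   vanishes where [f >= e], so the two summands are never nonzero together. *)
pose h x := f x - Num.min (f x) e + g x.
have cmin : continuous (fun x => Num.min (f x) e).
  by apply: continuous_minf => //; exact: continuous_cstf.
have cfm : continuous (fun x => f x - Num.min (f x) e) by exact: continuous_subf.
have bh : below V h.
  split; first exact: continuous_addf.
  - move=> x; have /andP[f0 f1] := f01 x; have /andP[g0 g1] := g01 x.
    have [fe|ef] := ltP (f x) e; rewrite /h.
      by rewrite min_l ?(ltW fe)// subrr add0r.
    rewrite min_r// gW; first by apply/andP; split; lra.
    by case=> _ /=; rewrite in_itv/= ltNge ef.
  - move=> x nVx; rewrite /h fU; last by case.
    by rewrite min_l ?(ltW e0)// subrr add0r gW//; case.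
have := lam_ub bh; rewrite /h LD// LB//.
have : L (fun x => Num.min (f x) e) <= e.
  rewrite -[leRHS]Lcst; apply: L_le => //; first exact: continuous_cstf.
  by move=> x; rewrite ge_min lexx orbT.
by lra.
Qed.

Let caratheodory_borel (B : set (borel X)) : measurable B -> om.-cara.-measurable B.
Proof.
move: B; apply: smallest_sub; first exact: sigma_algebra_measurable.
exact: caratheodory_open.
Qed.

Definition riesz_measure : set (borel X) -> \bar R := om.

Let riesz_measure0 : riesz_measure set0 = 0%E. Proof. exact: om0. Qed.

Let riesz_measure_ge0 B : (0 <= riesz_measure B)%E. Proof. exact: om_ge0. Qed.

Let riesz_measure_sigma_additive : semi_sigma_additive riesz_measure.
Proof.
move=> F mF tF mUF; apply: (@caratheodory_measure_sigma_additive R X om) => //.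
- by move=> n; exact: caratheodory_borel.
- exact: caratheodory_borel.
Qed.

HB.instance Definition _ := isMeasure.Build _ _ _ riesz_measure
  riesz_measure0 riesz_measure_ge0 riesz_measure_sigma_additive.

Let riesz_measureT : riesz_measure setT = 1%E.
Proof. by rewrite /riesz_measure om_open ?lamT//; exact: openT. Qed.

HB.instance Definition _ := Measure_isProbability.Build _ _ _ riesz_measure
  riesz_measureT.

Let P : probability (borel X) R := riesz_measure.

Let P_integrable f : continuous f -> P.-integrable setT (EFin \o f).
Proof.
move=> cf; have [M _ fM] := continuous_bounded Xc cf.
apply: (@bounded_integrable _ _ _ _ _ _ M) => //; first exact: probability_lty.
exact: continuous_borel.
Qed.

(* Slice [f] horizontally into [n] layers of height [1 / n]. *)
Let riesz_le01 f : continuous f -> (forall x, 0 <= f x <= 1) ->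
  L f <= \int[P]_x f x.
Proof.
move=> cf f01; apply/ler_addgt0Pr => e e0.
pose n := (Num.truncn e^-1).+1.
pose c : R := n%:R^-1.
have c0 : 0 < c by rewrite invr_gt0 ltr0n.
have ce : c <= e.
  by rewrite -(invrK e) lef_pV2 ?posrE ?ltr0n ?invr_gt0// ltW// truncnS_gt.
pose U k := f @^-1` `]k%:R * c, +oo[%classic.
have UE k x : U k x = (k%:R * c < f x) by rewrite /U/= in_itv/= andbT.
have oU k : open (U k).
  by move/continuousP: cf; apply; exact: interval_open.
pose g k x := \sum_(i < k) c * \1_(U i) x.
have mg k : measurable_fun [set: borel X] (g k : borel X -> R).
  apply: measurable_sum => i; apply: measurable_funM => //.
  by apply: measurable_indic; exact: open_borel.
have gS k x : g k.+1 x = g k x + c * \1_(U k) x by rewrite /g big_ord_recr.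
have indic01 k x : 0 <= (\1_(U k) x : R) <= 1.
  by rewrite indicE; case: (_ \in _); rewrite ?lexx ?ler01.
have g_ge0 k x : 0 <= g k x.
  by apply: sumr_ge0 => i _; rewrite mulr_ge0 ?(ltW c0)//; case/andP: (indic01 i x).
have g_lek k x : g k x <= k%:R * c.
  elim: k => [|k IH]; first by rewrite /g big_ord0 mul0r.
  rewrite gS -natr1 mulrDl mul1r lerD// -[leRHS]mulr1 ler_wpM2l ?(ltW c0)//.
have gi k : P.-integrable setT (EFin \o g k).
  apply: (@bounded_integrable _ _ _ _ _ _ (k%:R * c)) => //.
    exact: probability_lty.
  by move=> x _; rewrite ger0_norm.
pose h k x := Num.min (f x) (k%:R * c).
have ch k : continuous (h k).
  by apply: continuous_minf => //; exact: continuous_cstf.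
have Lh k : L (h k) <= \int[P]_x g k x.
  elim: k => [|k IH].
    rewrite (_ : h 0%N = fun=> 0) ?Lcst.
      by apply: Rintegral_ge0.
    by apply/funext => x; rewrite /h mul0r; apply/min_idPr; case/andP: (f01 x).
  (* The slice of [f] between the heights [k%:R * c] and [k.+1%:R * c], rescaled to [[0, 1]]. It
     vanishes outside [U k], so [L p] is at most the content of [U k], which is its measure since
     [U k] is open. *)
  pose p x := c^-1 * (h k.+1 x - h k x).
  have bp : below (U k) p.
    have kS : k.+1%:R * c = k%:R * c + c by rewrite -natr1 mulrDl mul1r.
    split.
    - by apply: continuous_scalef; exact: continuous_subf.
    - move=> x; rewrite /p mulrC ler_pdivlMr// mul0r ler_pdivrMr// mul1r /h kS.
      move: (k%:R * c) => a; rewrite /Num.min.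
      by case: ifPn; case: ifPn; rewrite -?leNgt => ? ?; apply/andP; split; lra.
    - move=> x; rewrite UE => /negP; rewrite -leNgt => fk.
      by rewrite /p /h kS !min_l ?subrr ?mulr0//; lra.
  have -> : L (h k.+1) = L (h k) + c * L p.
    rewrite -LZ; last by case: bp.
    rewrite -LD//; last by apply: continuous_scalef; case: bp.
    congr L; apply/funext => x; rewrite /p mulrA divff ?gt_eqF// mul1r.
    by rewrite addrC subrK.
  have Ui : P.-integrable setT (EFin \o (\1_(U k) : borel X -> R)).
    apply: (@bounded_integrable _ _ _ _ _ _ 1) => //; first exact: probability_lty.
      by apply: measurable_indic; exact: open_borel.
    by move=> x _; exact: indic_le1.
  have -> : \int[P]_x g k.+1 x = \int[P]_x g k x + c * lam (U k).
    under eq_Rintegral do rewrite gS.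
    rewrite RintegralD//; last exact: (integrableZl measurableT c Ui).
    rewrite RintegralZl// Rintegral_indic; last exact: open_borel.
    by rewrite /P/= /riesz_measure om_open.
  by rewrite lerD// ler_wpM2l ?(ltW c0)// lam_ub.
have := Lh n; rewrite (_ : h n = f); last first.
  apply/funext => x; rewrite /h divff ?pnatr_eq0// min_l//.
  by case/andP: (f01 x).
move=> /le_trans; apply.
apply: (@le_trans _ _ (\int[P]_x (f x + c))).
  apply: le_Rintegral => //.
    by apply: P_integrable; apply: continuous_addf => //; exact: continuous_cstf.
  (* The step function counts in full every layer that [f x] enters; only the last one may be
     incomplete, so the excess is at most one height [c]. *)
  move=> x _; suff H k : g k x <= h k x + c.
    by rewrite (le_trans (H n))// lerD2r ge_min lexx.
  elim: k => [|k IH]; first rewrite /g big_ord0 /h mul0r min_r.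
  - by rewrite add0r ltW.
  - by case/andP: (f01 x).
  rewrite gS indicE; have [kf|fk] := ltP (k%:R * c) (f x).
    rewrite mem_set ?UE// mulr1 lerD2r (le_trans (g_lek k x))// le_min ltW//=.
    by rewrite ler_wpM2r ?(ltW c0)// ler_nat.
  rewrite memNset; last by rewrite UE => /lt_geF; rewrite fk.
  rewrite mulr0 addr0 (le_trans IH)// lerD2r /h.
  rewrite le_min !ge_min lexx/=; apply/orP; right.
  by rewrite ler_wpM2r ?(ltW c0)// ler_nat.
rewrite RintegralD//; last 2 first.
- exact: P_integrable.
- by apply: P_integrable; exact: continuous_cstf.
by rewrite lerD2l Rintegral_cst_probability.
Qed.

Let riesz_le f : continuous f -> L f <= \int[P]_x f x.
Proof.
move=> cf; have [M M0 fM] := continuous_bounded Xc cf.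
pose g x := (2 * M)^-1 * (f x + M).
have c2M : 0 < 2 * M by rewrite mulr_gt0.
have fE : f = fun x => 2 * M * g x - M.
  by apply/funext => x; rewrite /g mulrA divff ?gt_eqF// mul1r addrK.
have cg : continuous g.
  by apply: continuous_scalef; apply: continuous_addf => //; exact: continuous_cstf.
rewrite fE LB; last 2 first.
- exact: continuous_scalef.
- exact: continuous_cstf.
rewrite RintegralB//; last 2 first.
- by apply: P_integrable; exact: continuous_scalef.
- by apply: P_integrable; exact: continuous_cstf.
rewrite LZ// Lcst RintegralZl//; last exact: P_integrable.
rewrite Rintegral_cst_probability lerD2r ler_wpM2l ?(ltW c2M)// riesz_le01// => x.
have := fM x; rewrite ler_norml => /andP[? ?].
by rewrite /g mulrC ler_pdivlMr// mul0r ler_pdivrMr// mul1r; apply/andP; split; lra.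
Qed.

(** The one-sided bound [riesz_le] suffices: applied to [- f], it is the reverse inequality. *)
Theorem riesz_representation : exists Q : probability (borel X) R,
  forall f, continuous f -> \int[Q]_x f x = L f.
Proof.
exists P => f cf; apply/eqP; rewrite eq_le riesz_le// andbT -lerN2.
have := riesz_le (continuous_oppf cf).
rewrite (_ : (fun x => - f x) = fun x => -1 * f x); last first.
  by apply/funext => x; rewrite mulN1r.
by rewrite LZ// RintegralZl ?P_integrable// !mulN1r.
Qed.

End Riesz.

(** * Monotone class arguments *)

Section MonotoneClass.
Variables (R : realType) (X : pmetricType R) (H : set (X -> R)).
Hypothesis H_continuous : forall f : X -> R, continuous f -> H f.
Hypothesis H_add : forall f g, H f -> H g -> H (fun x => f x + g x).
Hypothesis H_scale : forall a f, H f -> H (fun x => a * f x).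
Hypothesis H_lim : forall (F : nat -> X -> R) (f : X -> R) (M : R),
  (forall n, H (F n)) -> (forall n x, `|F n x| <= M) ->
  (forall x, F n x @[n --> \oo] --> f x) -> H f.

Let H_cst a : H (fun=> a).
Proof. by apply: H_continuous; exact: continuous_cstf. Qed.

Let H_sum (F : nat -> X -> R) n : (forall k, H (F k)) -> H (fun x => \sum_(k < n) F k x).
Proof.
move=> HF; elim: n => [|n IH].
  by rewrite (_ : (fun x => _) = fun=> 0)//; apply/funext => x; rewrite big_ord0.
rewrite (_ : (fun x => _) = fun x => \sum_(k < n) F k x + F n x); first exact: H_add.
by apply/funext => x; rewrite big_ord_recr.
Qed.

(** For a bump [f] that is positive exactly on [U], the continuous functions [min 1 (n * f)] stay
    bounded and tend to the indicator. *)
Let H_open (U : set X) : open U -> H (\1_U).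
Proof.
move=> oU; have [f [cf f01 Uf]] := open_bump oU.
apply: (@H_lim (fun n x => Num.min 1 (n%:R * f x)) _ 1).
- move=> n; apply: H_continuous; apply: continuous_minf; first exact: continuous_cstf.
  exact: continuous_scalef.
- move=> n x; have /andP[f0 _] := f01 x.
  rewrite ger0_norm ?ge_min ?lexx//.
  by rewrite le_min ler01 mulr_ge0.
- move=> x; have /andP[f0 f1] := f01 x; apply: cvg_near_cst.
  have [Ux|nUx] := pselect (U x).
    have fx0 : 0 < f x by apply/Uf.
    exists (Num.truncn (f x)^-1).+1 => // n /= fn.
    rewrite indicE mem_set//; apply/min_idPl.
    rewrite -ler_pdivrMr// mul1r ltW// (lt_le_trans (truncnS_gt _))//.
    by rewrite ler_nat.
  apply: nearW => n; rewrite indicE memNset// (_ : f x = 0) ?mulr0 ?min_r//.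
  by apply/eqP; rewrite eq_le f0 andbT leNgt; apply/negP => /Uf.
Qed.

(** Dynkin's theorem: open sets are closed under intersection and generate the Borel sets. For a
    disjoint union, indicators of finite unions are sums, and the countable union is their bounded
    limit. *)
Let H_indic (B : set (borel X)) : measurable B -> H (\1_B).
Proof.
move: B; apply: (@dynkin_induction _ (borel X) (@open X) (fun B => H (\1_B))) => //.
- by move=> U V oU oV; exact: openI.
- by apply: H_open; exact: openT.
- move=> B mB HB; rewrite (_ : \1_(~` B) = fun x => 1 + -1 * \1_B x).
    by apply: H_add => //; exact: H_scale.
  apply/funext => x; rewrite !indicE in_setC; case: (_ \in _);
      by rewrite /= ?mulr1 ?mulr0 ?subrr ?addr0.
- move=> F mF tF HF; pose G n := \bigcup_(k in `I_n) F k.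
  have HG n : H (\1_(G n)).
    elim: n => [|n IH].
      by rewrite /G II0 bigcup_set0 indic0; exact: H_cst.
    rewrite (_ : \1_(G n.+1) = fun x => \1_(G n) x + \1_(F n) x); first exact: H_add.
    apply/funext => x; rewrite !indicE.
    have [Fnx|nFnx] := pselect (F n x).
      rewrite [x \in F n]mem_set// mem_set; last by exists n => /=.
      rewrite memNset ?add0r// => -[k /= kn Fkx].
      have /trivIsetP/(_ k n I I) := tF.
      rewrite (ltn_eqF kn) => /(_ isT); rewrite -subset0 => /(_ x); exact.
    rewrite [x \in F n]memNset// addr0; congr (nat_of_bool _)%:R.
    apply/idP/idP; rewrite !inE => -[k /= kn Fkx].
      by exists k => //=; move: kn; rewrite ltnS leq_eqVlt => /predU1P[kE|//]; rewrite kE in Fkx.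
    by exists k => //=; rewrite ltnW.
  apply: (@H_lim (fun n => \1_(G n)) _ 1) => //.
    by move=> n x; exact: indic_le1.
  move=> x; apply: cvg_near_cst; rewrite !indicE.
  have [[n _ Fnx]|nFx] := pselect ((\bigcup_k F k) x).
    exists n.+1 => // m /= nm; rewrite !indicE !mem_set//; last by exists n.
    by exists n.
  apply: nearW => n; rewrite !indicE !memNset//.
  by apply: contra_not nFx => -[k _ Fkx]; exists k.
Qed.

Import HBNNSimple.

Let H_unit (f : borel X -> R) : measurable_fun setT f -> (forall x, 0 <= f x <= 1) -> H f.
Proof.
move=> mf f01.
have mf' : measurable_fun setT (EFin \o f) by exact/measurable_EFinP.
have f0 (x : borel X) : setT x -> (0 <= (EFin \o f) x)%E.
  by move=> _; rewrite lee_fin; case/andP: (f01 x).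
pose F n : X -> R := nnsfun_approx measurableT mf' n.
refine (@H_lim F f 1 _ _ _).
- move=> n.
  pose s := finmap.enum_fset (fset_set (F n @` setT)).
  rewrite (_ : F n = fun x => \sum_(i < size s) (s`_i * \1_(F n @^-1` [set s`_i]) x)); last first.
    by apply/funext => x; exact: (fimfunEord (nnsfun_approx measurableT mf' n)).
  apply: (@H_sum (fun i x => s`_i * \1_(F n @^-1` [set s`_i]) x)) => k.
  apply: H_scale; apply: H_indic.
  rewrite -[X in measurable X]setTI; exact: measurable_funPT.
- move=> n x; rewrite ger0_norm; last exact: fun_ge0.
  rewrite /F nnsfun_approxE -lee_fin (le_trans (le_approx _ f0 _))//.
  by rewrite lee_fin; case/andP: (f01 x).
- move=> x; have := cvg_approx f0 (I : setT x) (ltry _).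
  by under eq_fun do rewrite -(nnsfun_approxE measurableT mf').
Qed.

Lemma monotone_class (f : borel X -> R) M : measurable_fun setT f ->
  (forall x, `|f x| <= M) -> H f.
Proof.
move=> mf fM; pose N := `|M| + 1.
have N0 : 0 < N by rewrite ltr_wpDl.
have c2N : 0 < 2 * N by rewrite mulr_gt0.
have fN x : `|f x| <= N.
  by rewrite (le_trans (fM x))// (le_trans (ler_norm _))// lerDl.
pose g x := (2 * N)^-1 * (f x + N).
have -> : f = fun x => 2 * N * g x + - N.
  by apply/funext => x; rewrite /g mulrA divff ?gt_eqF// mul1r addrK.
apply: H_add => //; apply: H_scale; apply: H_unit.
  by apply: measurable_funM => //; apply: measurable_funD.
move=> x; have := fN x; rewrite ler_norml => /andP[? ?].
by rewrite /g mulrC ler_pdivlMr// mul0r ler_pdivrMr// mul1r; apply/andP; split; lra.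
Qed.

End MonotoneClass.

(** * Bounded measurable functions and uniqueness of measures *)

Section BoundedMeasurable.
Context {d : measure_display} {T : measurableType d} {R : realType}.
Implicit Types (f g : T -> R).

Definition bounded_measurable f :=
  measurable_fun setT f /\ exists M, forall x, `|f x| <= M.

Lemma bounded_measurableD f g : bounded_measurable f -> bounded_measurable g ->
  bounded_measurable (fun x => f x + g x).
Proof.
move=> [mf [M fM]] [mg [N gN]]; split; first exact: measurable_funD.
by exists (M + N) => x; rewrite (le_trans (ler_normD _ _))// lerD.
Qed.

Lemma bounded_measurableM f g : bounded_measurable f -> bounded_measurable g ->
  bounded_measurable (fun x => f x * g x).
Proof.
move=> [mf [M fM]] [mg [N gN]]; split; first exact: measurable_funM.
by exists (M * N) => x; rewrite normrM ler_pM.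
Qed.

Lemma bounded_measurable_cst a : bounded_measurable (fun=> a).
Proof. by split; [exact: measurable_cst|exists `|a|]. Qed.

Lemma bounded_measurableZ a f : bounded_measurable f ->
  bounded_measurable (fun x => a * f x).
Proof. by move=> bf; apply: bounded_measurableM => //; exact: bounded_measurable_cst. Qed.

Lemma bounded_measurableB f g : bounded_measurable f -> bounded_measurable g ->
  bounded_measurable (fun x => f x - g x).
Proof.
move=> bf /(bounded_measurableZ (-1)) bg.
by have := bounded_measurableD bf bg; under eq_fun do rewrite mulN1r.
Qed.

Lemma bounded_measurable_cvg (F : nat -> T -> R) f M :
  (forall n, measurable_fun setT (F n)) -> (forall n x, `|F n x| <= M) ->
  (forall x, F n x @[n --> \oo] --> f x) -> bounded_measurable f.
Proof.
move=> mF FM Ff; split; first by apply: (measurable_fun_cvg mF) => x _; exact: Ff.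
by exists M => x; apply: (cvgr_to_le (cvg_norm (Ff x))); exact: nearW.
Qed.

Lemma bounded_measurable_indic (A : set T) : measurable A ->
  bounded_measurable (\1_A : T -> R).
Proof. by move=> mA; split; [exact: measurable_indic|exists 1 => x; exact: indic_le1]. Qed.

Lemma bounded_measurable_integrable (P : probability T R) f :
  bounded_measurable f -> P.-integrable setT (EFin \o f).
Proof.
move=> [mf [M fM]]; apply: (@bounded_integrable _ _ _ _ _ _ M) => //.
exact: probability_lty.
Qed.

End BoundedMeasurable.

Lemma continuous_bounded_measurable (R : realType) (X : pmetricType R) (f : X -> R) :
  compact [set: X] -> continuous f -> bounded_measurable (f : borel X -> R).
Proof.
move=> Xc cf; split; first exact: continuous_borel.
by have [M _ fM] := continuous_bounded Xc cf; exists M.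
Qed.

(** Bounded measurability is carried along with [H], so that each closure hypothesis may assume it;
    integrals can then be split and passed to the limit. *)
Lemma bounded_monotone_class (R : realType) (X : pmetricType R)
    (H : (borel X -> R) -> Prop) : compact [set: X] ->
  (forall f : X -> R, continuous f -> H f) ->
  (forall f g, bounded_measurable f -> bounded_measurable g -> H f -> H g ->
    H (fun x => f x + g x)) ->
  (forall a f, bounded_measurable f -> H f -> H (fun x => a * f x)) ->
  (forall F f M, (forall n, bounded_measurable (F n)) ->
    (forall n x, `|F n x| <= M) ->
    (forall x, F n x @[n --> \oo] --> f x) -> (forall n, H (F n)) -> H f) ->
  forall f, bounded_measurable f -> H f.
Proof.
move=> Xc Hc HD HZ Hlim f [mf [M fM]].
suff [] : bounded_measurable f /\ H f by [].
apply: (@monotone_class R X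
  [set g : X -> R | bounded_measurable (g : borel X -> R) /\ H g] _ _ _ _ f M) => //.
- by move=> g cg; split; [exact: continuous_bounded_measurable|exact: Hc].
- by move=> g h [bg Hg] [bh Hh]; split; [exact: bounded_measurableD|exact: HD].
- by move=> a g [bg Hg]; split; [exact: bounded_measurableZ|exact: HZ].
- move=> F g N HF FN Fg; split.
    apply: (@bounded_measurable_cvg _ (borel X) R F g N) => // n.
    by have [[]] := HF n.
  by apply: (Hlim F g N) => // n; have [] := HF n.
Qed.

(** The weight [w], the map [h] and the factor [c] let one extension argument serve three times: for
    the uniqueness of a measure ([w = 1], [h = id]), for invariance ([h = S t]) and for ergodicity
    ([w] an indicator, [c] its integral). *)
Lemma Rintegral_unique (R : realType) (X : pmetricType R)
    (P Q : probability (borel X) R) (w : borel X -> R) (h : borel X -> borel X) (c : R) :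
  compact [set: X] -> bounded_measurable w -> measurable_fun setT h ->
  (forall f : X -> R, continuous f ->
    \int[P]_x (w x * f (h x)) = c * \int[Q]_x f x) ->
  forall f, bounded_measurable f -> \int[P]_x (w x * f (h x)) = c * \int[Q]_x f x.
Proof.
move=> Xc bw mh PQ.
have bwh f : bounded_measurable f -> bounded_measurable (fun x => w x * f (h x)).
  move=> [mf [M fM]]; apply: bounded_measurableM => //; split.
    exact: (measurableT_comp mf mh).
  by exists M => x; exact: fM.
have bi := bounded_measurable_integrable.
apply: (@bounded_monotone_class R X) => //.
- move=> f g bf bg PQf PQg.
  under eq_Rintegral do rewrite mulrDr.
  by rewrite !RintegralD// ?PQf ?PQg ?mulrDr//; (apply: bi => //; exact: bwh).
- move=> a f bf PQf.
  under eq_Rintegral do rewrite mulrCA.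
  rewrite (@RintegralZl _ _ _ Q)//; last exact: bi.
  rewrite RintegralZl//; last by apply: bi; exact: bwh.
  by rewrite PQf; exact: mulrCA.
- move=> F f M bF FM Ff PQF.
  have [W wW] := bw.2.
  have cvP : \int[P]_x (w x * F n (h x)) @[n --> \oo] --> \int[P]_x (w x * f (h x)).
    apply: (@bounded_convergence _ _ _ _ _ _ _ (W * M)) => //.
    - exact: probability_lty.
    - by move=> n; have [] := bwh _ (bF n).
    - by move=> n x _; rewrite normrM ler_pM.
    - by move=> x _; apply: cvgM; [exact: cvg_cst|exact: Ff].
  have cvQ : \int[Q]_x F n x @[n --> \oo] --> \int[Q]_x f x.
    apply: (@bounded_convergence _ _ _ _ _ _ _ M) => //.
      exact: probability_lty.
    by move=> n; case: (bF n).
  apply: (cvg_unique (@Rhausdorff R) cvP).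
  rewrite (_ : (fun n => _) = fun n => c * \int[Q]_x F n x).
    by apply: cvgM; [exact: cvg_cst|exact: cvQ].
  by apply/funext => n; exact: PQF.
Qed.

Lemma probability_unique (R : realType) (X : pmetricType R)
    (P Q : probability (borel X) R) : compact [set: X] ->
  (forall f : X -> R, continuous f -> \int[P]_x f x = \int[Q]_x f x) ->
  forall B : set (borel X), measurable B -> P B = Q B.
Proof.
move=> Xc PQ B mB.
have := @Rintegral_unique R X P Q (fun=> 1) id 1 Xc (bounded_measurable_cst 1)
  (@measurable_id _ _ _) _ _ (bounded_measurable_indic mB).
under eq_Rintegral do rewrite mul1r.
rewrite mul1r !Rintegral_indic// => PQB.
rewrite -(fineK (fin_num_measure P _ mB)) PQB ?fineK// ?fin_num_measure//.
by move=> f cf; rewrite mul1r -PQ//; apply: eq_Rintegral => x _; rewrite mul1r.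
Qed.

Lemma measurable_gt (d : measure_display) (T : measurableType d) (R : realType)
  (f : T -> R) (a : R) : measurable_fun setT f -> measurable [set x | a < f x].
Proof.
move=> mf; rewrite (_ : mkset _ = setT `&` f @^-1` `]a, +oo[); first exact: mf.
by rewrite setTI; apply/seteqP; split => x /=; rewrite in_itv/= andbT.
Qed.

(** * Birkhoff's ergodic theorem *)

Section Frequently.
Variable R : realType.
Implicit Types (u v : R^nat) (a b c : R).

(* [b < limsup u] *)
Definition frequently_gt u b :=
  exists q : rat, b < ratr q /\ forall N, exists2 n, (N <= n)%N & ratr q < u n.

Lemma frequently_gtI u b c : b < c -> (forall N, exists2 n, (N <= n)%N & c <= u n) ->
  frequently_gt u b.
Proof.
move=> /rat_in_itvoo[q]; rewrite in_itv/= => /andP[bq qc] uc; exists q; split => // N.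
by have [n Nn cu] := uc N; exists n => //; exact: lt_le_trans cu.
Qed.

Lemma frequently_gt_near u v b : (fun n => u n - v n) @ \oo --> (0 : R) ->
  frequently_gt u b -> frequently_gt v b.
Proof.
move=> /cvgrPdist_lt uv [q [bq uq]].
pose e := (ratr q - b) / 2.
have e0 : 0 < e by rewrite divr_gt0// subr_gt0.
apply: (@frequently_gtI _ _ (b + e)); first by rewrite ltrDl.
move=> N; have [M _ Mv] := uv _ e0.
have [n Nn un] := uq (maxn N M); exists n.
  by rewrite (leq_trans _ Nn)// leq_maxl.
have /= := Mv n (leq_trans (leq_maxr _ _) Nn).
rewrite sub0r normrN ltr_norml => /andP[_ uve].
have : e + e = ratr q - b by rewrite /e -splitr.
by move=> ?; lra.
Qed.

(** The second condition of the excluded pair says [liminf u < a]. Here [sup E] is the upper limit;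
    if [u] went below [sup E - e] infinitely often, two rationals between [sup E - e] and an element
    of [E] would form such a pair. *)
Lemma cvg_frequently u M : (forall n, `|u n| <= M) ->
  (forall a b : rat, a < b -> ~ (frequently_gt u (ratr b) /\
    frequently_gt (fun n => - u n) (- ratr a))) -> cvgn u.
Proof.
move=> uM nab.
have uM' n : - M <= u n <= M by rewrite -ler_norml.
pose E := [set b | frequently_gt u b].
have EM b : E b -> b <= M.
  move=> [q [bq /(_ 0%N)[n _ un]]]; have /andP[_ h] := uM' n.
  by rewrite ltW// (lt_trans bq)// (lt_le_trans un).
(* The bound is lowered by [1] because [frequently_gt] is strict and [u] may be constantly [- M]. *)
have E0 : E (- M - 1).
  apply: (@frequently_gtI _ _ (- M)); first by lra.
  by move=> N; exists N => //; case/andP: (uM' N).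
have hE : has_sup E by split; [exists (- M - 1)|exists M].
apply/cvg_ex; exists (sup E); apply/cvgrPdist_le => e e0.
suff [A [B [HA HB]]] : exists A B, (forall n, (A <= n)%N -> u n <= sup E + e) /\
    (forall n, (B <= n)%N -> sup E - e <= u n).
  exists (maxn A B) => // n /= ABn.
  have := HA n (leq_trans (leq_maxl _ _) ABn).
  have := HB n (leq_trans (leq_maxr _ _) ABn).
  by move=> ? ?; rewrite ler_norml; apply/andP; split; lra.
suff [[A HA] [B HB]] : (exists A, forall n, (A <= n)%N -> u n <= sup E + e) /\
    (exists B, forall n, (B <= n)%N -> sup E - e <= u n) by exists A, B.
split; apply: contrapT => /forallNP h.
  have : E (sup E + e / 2).
    apply: (@frequently_gtI _ _ (sup E + e)); first by lra.
    move=> N; have /existsNP[n /not_implyP[Nn /negP un]] := h N.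
    by exists n => //; rewrite ltW// ltNge.
  by move=> /(sup_upper_bound hE); lra.
have [b Eb bE] := sup_adherent (divr_gt0 e0 (ltr0n _ 2)) hE.
have /rat_in_itvoo[a] : sup E - e < (sup E - e / 2) by lra.
have /rat_in_itvoo[c] : sup E - e / 2 < b by lra.
rewrite !in_itv/= => /andP[c1 c2] /andP[a1 a2].
apply: (nab a c); first by rewrite -(ltr_rat R); exact: lt_trans c1.
split.
  by case: Eb => q [bq Eq]; exists q; split => //; exact: lt_trans bq.
apply: (@frequently_gtI _ _ (- (sup E - e))); first by rewrite ltrN2.
move=> N; have /existsNP[n /not_implyP[Nn /negP un]] := h N.
by exists n => //; rewrite lerN2 ltW// ltNge.
Qed.

(** The rational built into [frequently_gt] makes this a countable union. *)
Lemma measurable_frequently_gt d (T : measurableType d) (F : nat -> T -> R) b :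
  (forall n, measurable_fun setT (F n)) ->
  measurable [set x | frequently_gt (F ^~ x) b].
Proof.
move=> mF.
rewrite (_ : mkset _ = \bigcup_(q : rat) (if b < ratr q then
  \bigcap_N \bigcup_(n in [set n | (N <= n)%N]) [set x | ratr q < F n x] else set0)).
  apply: bigcupT_measurable_rat => q; case: ifPn => // _.
  apply: bigcapT_measurable => N; apply: bigcup_measurable => n _.
  exact: measurable_gt.
apply/seteqP; split => [x [q [bq uq]]|x [q _]].
  by exists q => //; rewrite bq => N _; have [n] := uq N; exists n.
by case: ifPn => // bq uq; exists q; split => // N; have [n] := uq N I; exists n.
Qed.

End Frequently.

Lemma countable_enum (I : Type) (D : set I) : D !=set0 -> countable D ->
  exists2 e : nat -> I, forall n, D (e n) & forall i, D i -> exists n, e n = i.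
Proof.
move=> D0 cD; have [/eqP|[e]] := pfcard_geP cD; first by move/set0P: D0 => /negP.
exists e => [n|i Di]; first exact: funS.
by have [n _ <-] := @surj _ _ _ _ e i Di; exists n.
Qed.

Lemma ae_impl d (T : measurableType d) (R : realType)
    (mu : {measure set T -> \bar R}) (A B : T -> Prop) :
  (forall x, A x -> B x) -> {ae mu, forall x, A x} -> {ae mu, forall x, B x}.
Proof. exact: filterS. Qed.

Lemma ae_impl2 d (T : measurableType d) (R : realType)
    (mu : {measure set T -> \bar R}) (A B C : T -> Prop) :
  (forall x, A x -> B x -> C x) -> {ae mu, forall x, A x} ->
  {ae mu, forall x, B x} -> {ae mu, forall x, C x}.
Proof. exact: filterS2. Qed.

Lemma ae_countable d (T : measurableType d) (R : realType)
    (mu : {measure set T -> \bar R}) (I : Type) (D : set I) (Q : I -> T -> Prop) :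
  countable D -> (forall i, D i -> {ae mu, forall x, Q i x}) ->
  {ae mu, forall x, forall i, D i -> Q i x}.
Proof.
move=> cD QD; have [->|/set0P D0] := eqVneq D set0; first exact: aeW.
have [e De eD] := countable_enum D0 cD.
have /ae_foralln := fun n => QD _ (De n).
by apply: filterS => x Qx i /eD[n <-]; exact: Qx.
Qed.

Section Birkhoff.
Context {d : measure_display} {T : measurableType d} {R : realType}.
Variables (P : probability T R) (tau : T -> T).
Hypothesis mtau : measurable_fun setT tau.
Hypothesis Ptau : forall B, measurable B -> P (tau @^-1` B) = P B.
Implicit Types (f g : T -> R) (E : set T).

Lemma bounded_measurable_comp f : bounded_measurable f -> bounded_measurable (f \o tau).
Proof.
move=> [mf [M fM]]; split; first exact: measurableT_comp.
by exists M => x; exact: fM.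
Qed.

Lemma Rintegral_comp f : bounded_measurable f -> \int[P]_x f (tau x) = \int[P]_x f x.
Proof.
move=> bf; rewrite /Rintegral; congr fine.
have := @integral_pushforward _ _ _ _ R tau mtau P setT (EFin \o f).
rewrite preimage_setT => <-//.
- by apply: eq_measure_integral => A mA _; exact: Ptau.
- by case: bf => mf _; exact/measurable_EFinP.
- exact/bounded_measurable_integrable/bounded_measurable_comp.
Qed.

Definition ergodic_sum f n x := \sum_(k < n) f (iter k tau x).

Lemma ergodic_sumS f n x : ergodic_sum f n.+1 x = f x + ergodic_sum f n (tau x).
Proof.
rewrite /ergodic_sum big_ord_recl/=; congr (_ + _).
by apply: eq_bigr => i _; rewrite -iterSr.
Qed.

Lemma bounded_measurable_iter f k : bounded_measurable f ->
  bounded_measurable (fun x => f (iter k tau x)).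
Proof.
elim: k f => [//|k IH] f bf.
rewrite (_ : (fun x => _) = (fun x => f (iter k tau x)) \o tau).
  by apply: bounded_measurable_comp; exact: IH.
by apply/funext => x; rewrite iterSr.
Qed.

Lemma bounded_measurable_ergodic_sum f n : bounded_measurable f ->
  bounded_measurable (ergodic_sum f n).
Proof.
move=> bf; elim: n => [|n IH].
  rewrite (_ : ergodic_sum f 0 = fun=> 0); first exact: bounded_measurable_cst.
  by apply/funext => x; rewrite /ergodic_sum big_ord0.
rewrite (_ : ergodic_sum f n.+1 = fun x => ergodic_sum f n x + f (iter n tau x)).
  by apply: bounded_measurableD => //; exact: bounded_measurable_iter.
by apply/funext => x; rewrite /ergodic_sum big_ord_recr.
Qed.

(* [max_sum f n] is the maximum of [ergodic_sum f k] over [k <= n]. *)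
Fixpoint max_sum f n x :=
  if n is m.+1 then Num.max 0 (f x + max_sum f m (tau x)) else 0.

Lemma max_sum_ge0 f n x : 0 <= max_sum f n x.
Proof. by case: n => [|n] //=; rewrite le_max lexx. Qed.

Lemma max_sum_leS f n x : max_sum f n x <= max_sum f n.+1 x.
Proof.
elim: n x => [|n IH] x; first exact: max_sum_ge0.
rewrite [leLHS]/= ge_max max_sum_ge0/= [leRHS]/= le_max; apply/orP; right.
by rewrite lerD2l; exact: IH.
Qed.

Lemma ergodic_sum_le_max f k n x : (k <= n)%N -> ergodic_sum f k x <= max_sum f n x.
Proof.
elim: n k x => [|n IH] [|k] x //=; try by rewrite /ergodic_sum big_ord0 ?le_max lexx.
by move=> kn; rewrite ergodic_sumS le_max lerD2l IH// orbT.
Qed.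

Lemma bounded_measurable_max_sum f n : bounded_measurable f ->
  bounded_measurable (max_sum f n).
Proof.
move=> bf; elim: n => [|n IH]; first exact: bounded_measurable_cst.
have [mg [M gM]] := bounded_measurableD bf (bounded_measurable_comp IH).
split; first by apply: measurable_maxr.
exists M => x; rewrite ger0_norm ?max_sum_ge0//= ge_max.
by rewrite (le_trans _ (gM x))//= (le_trans (ler_norm _) (gM x)).
Qed.

(** Garsia's argument. Let [F = max_sum f n.+1]. Where [F > 0], the recursion gives
    [F <= f + F \o tau]; elsewhere [F = 0 <= F \o tau]. So [F - F \o tau] is at most the integrand
    everywhere, and its integral is [0] by invariance. *)
Lemma maximal_inequality f n : bounded_measurable f ->
  0 <= \int[P]_x (f x * \1_[set x | 0 < max_sum f n.+1 x] x).
Proof.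
move=> bf; set A := mkset _.
have bF := bounded_measurable_max_sum n.+1 bf.
have bF' := bounded_measurable_comp bF.
have mA : measurable A by apply: measurable_gt; case: bF.
rewrite -(subrr (\int[P]_x max_sum f n.+1 x)) -{2}(Rintegral_comp bF).
have bi := bounded_measurable_integrable.
rewrite -RintegralB//; [|exact: bi..].
apply: le_Rintegral => //.
- by apply: bi; exact: bounded_measurableB.
- by apply: bi; apply: bounded_measurableM => //; exact: bounded_measurable_indic.
- move=> x _; rewrite indicE; have [Ax|nAx] := pselect (A x).
    rewrite mem_set// mulr1 lerBlDr.
    apply: (@le_trans _ _ (f x + max_sum f n (tau x))).
      by move: Ax; rewrite /A/= lt_max ltxx/= => h; rewrite ge_max lexx ltW.
    by rewrite lerD2l max_sum_leS.
  rewrite memNset// mulr0 subr_le0 (le_trans _ (max_sum_ge0 _ _ _))//.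
  by rewrite leNgt; apply/negP.
Qed.

(** Since [E] is invariant, cutting [f] off outside [E] leaves its ergodic sums unchanged on [E] and
    makes them vanish elsewhere. The sets of the maximal inequality for the truncated function then
    exhaust [E], and the inequality passes to the limit. *)
Lemma maximal_ergodic f E : bounded_measurable f -> measurable E ->
  (forall x, E (tau x) <-> E x) ->
  (forall x, E x -> exists n, 0 < ergodic_sum f n x) ->
  0 <= \int[P]_x (f x * \1_E x).
Proof.
move=> bf mE tE Epos.
pose g x := f x * \1_E x.
have bg : bounded_measurable g.
  by apply: bounded_measurableM => //; exact: bounded_measurable_indic.
have gE n x : E x -> ergodic_sum g n x = ergodic_sum f n x.
  move=> Ex; apply: eq_bigr => k _; rewrite /g indicE mem_set ?mulr1//.
  by elim: (nat_of_ord k) => [//|m IH]; rewrite iterS tE.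
have g0 n x : ~ E x -> max_sum g n x = 0.
  elim: n x => [//|n IH] x nEx /=; rewrite IH ?tE// addr0.
  by rewrite /g indicE memNset// mulr0 maxxx.
pose A n := [set x | 0 < max_sum g n.+1 x].
have mA n : measurable (A n).
  by apply: measurable_gt; have [] := bounded_measurable_max_sum n.+1 bg.
have [M gM] := bg.2.
have cv : \int[P]_x (g x * \1_(A n) x) @[n --> \oo] --> \int[P]_x g x.
  apply: (@bounded_convergence _ _ _ _ _ _ _ M) => //.
  - exact: probability_lty.
  - by move=> n; apply: measurable_funM; [case: bg|exact: measurable_indic].
  - move=> n x _; rewrite normrM -[leRHS]mulr1 ler_pM//; exact: indic_le1.
  - move=> x _; apply: cvg_near_cst; have [Ex|nEx] := pselect (E x).
      have [m fm] := Epos x Ex.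
      exists m => // n /= mn; rewrite indicE mem_set ?mulr1// /A/=.
      rewrite (lt_le_trans fm)// -gE//.
      by apply: (@ergodic_sum_le_max g m n.+1); rewrite (leq_trans mn).
    by apply: nearW => n; rewrite /g !indicE [x \in E]memNset// mulr0 mul0r.
apply: (cvgr_to_ge cv); apply: nearW => n; exact: maximal_inequality.
Qed.

(** Let [E a b] be the set where the lower limit of the averages is below [a] and the upper one
    above [b]. It is invariant, as the averages at [x] and [tau x] differ by
    [(f x - f (iter n tau x)) / n]. For [a < b], adding the maximal inequalities for [f - b] and
    [a - f] on it gives [0 <= (a - b) * P (E a b)], so it is null; there are countably many rational
    pairs. *)
Lemma birkhoff f : bounded_measurable f ->
  {ae P, forall x, cvgn (fun n => n%:R^-1 * ergodic_sum f n x)}.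
Proof.
move=> bf; pose A n x := n%:R^-1 * ergodic_sum f n x.
have bi := bounded_measurable_integrable.
have [M0 fM0] := bf.2.
have [M M_ge0 fM] : exists2 M, 0 <= M & forall x, `|f x| <= M.
  by exists `|M0| => // x; rewrite (le_trans (fM0 x))// ler_norm.
have AM n x : `|A n x| <= M.
  rewrite normrM normfV [`|n%:R|]normr_nat.
  have [->|n0] := posnP n; first by rewrite invr0 mul0r.
  rewrite mulrC ler_pdivrMr ?ltr0n// (le_trans (ler_norm_sum _ _ _))//.
  apply: (@le_trans _ _ (\sum_(k < n) M)); first by apply: ler_sum.
  by rewrite sumr_const card_ord mulr_natr.
have mA n : measurable_fun setT (A n).
  apply: measurable_funM => //.
  by have [] := bounded_measurable_ergodic_sum n bf.
have Atau x : (fun n => A n x - A n (tau x)) @ \oo --> (0 : R).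
  have AE n : A n x - A n (tau x) = n%:R^-1 * (f x - f (iter n tau x)).
    rewrite /A -mulrBr; congr (_ * _).
    have := ergodic_sumS f n x; rewrite {1}/ergodic_sum big_ord_recr/=.
    by rewrite -/(ergodic_sum f n x); lra.
  apply/cvgrPdist_le => e e0; near=> n; rewrite AE sub0r normrN normrM normfV.
  rewrite normr_nat mulrC ler_pdivrMr; last by rewrite ltr0n; near: n; exact: nbhs_infty_gt.
  rewrite (@le_trans _ _ (2 * M))//.
    by rewrite (le_trans (ler_normB _ _))// mulr2n mulrDl !mul1r lerD.
  rewrite -ler_pdivrMl//; near: n; exact: nbhs_infty_ger.
pose E (a b : rat) := [set x | frequently_gt (A ^~ x) (ratr b) /\
  frequently_gt (fun n => - A n x) (- ratr a)].
have mE a b : measurable (E a b).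
  apply: measurableI; first exact: measurable_frequently_gt.
  apply: (@measurable_frequently_gt _ _ _ (fun n x => - A n x)) => n.
  exact: measurableT_comp.
have PE a b : a < b -> P (E a b) = 0%E.
  move=> ab.
  have inv x : E a b (tau x) <-> E a b x.
    split=> -[hb ha]; split.
    - apply: frequently_gt_near hb; rewrite -oppr0; apply: cvg_trans (cvgN (Atau x)).
      by apply: near_eq_cvg; apply: nearW => n /=; rewrite fctE opprB.
    - apply: frequently_gt_near ha; apply: cvg_trans (Atau x).
      by apply: near_eq_cvg; apply: nearW => n /=; rewrite opprK addrC.
    - exact: frequently_gt_near hb.
    - apply: frequently_gt_near ha; rewrite -oppr0; apply: cvg_trans (cvgN (Atau x)).
      by apply: near_eq_cvg; apply: nearW => n /=; rewrite fctE opprK opprB addrC.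
  (* The bound [1 <= n] excludes the average of index [0], which is [0] by the convention on
     inverses. It is supplied by taking [N = 1] in [frequently_gt]. *)
  have sum_gt g c x : (exists2 n, (1 <= n)%N & c < n%:R^-1 * ergodic_sum g n x) ->
      exists n, 0 < ergodic_sum (fun y => g y - c) n x.
    move=> [n n0]; rewrite mulrC ltr_pdivlMr ?ltr0n// => cg; exists n.
    by rewrite /ergodic_sum sumrB sumr_const card_ord subr_gt0 -mulr_natr.
  have bE : bounded_measurable (\1_(E a b) : T -> R) by exact: bounded_measurable_indic.
  have bb : bounded_measurable (fun x => f x - ratr b).
    by apply: bounded_measurableB => //; exact: bounded_measurable_cst.
  have ba : bounded_measurable (fun x => -1 * f x - - ratr a).
    apply: bounded_measurableB; last exact: bounded_measurable_cst.
    exact: bounded_measurableZ.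
  have Hb : 0 <= \int[P]_x ((f x - ratr b) * \1_(E a b) x).
    apply: maximal_ergodic => // x [[q [bq /(_ 1%N)[n n1 An]]] _].
    by apply: sum_gt; exists n => //; exact: lt_trans An.
  have Ha : 0 <= \int[P]_x ((-1 * f x - - ratr a) * \1_(E a b) x).
    apply: maximal_ergodic => // x [_ [q [aq /(_ 1%N)[n n1 An]]]].
    apply: sum_gt; exists n => //; apply: (lt_trans aq); rewrite (lt_le_trans An)//.
    rewrite /A -mulrN le_eqVlt; apply/orP; left; apply/eqP; congr (_ * _).
    by rewrite /ergodic_sum -sumrN; apply: eq_bigr => k _; rewrite mulN1r.
  have := addr_ge0 Hb Ha; rewrite -RintegralD//; last 2 first.
  - by apply: bi; exact: bounded_measurableM.
  - by apply: bi; exact: bounded_measurableM.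
  rewrite (@eq_Rintegral _ _ _ _ _ (fun x => (ratr a - ratr b) * \1_(E a b) x)); last first.
    by move=> x _; ring.
  rewrite RintegralZl//; last exact: bi.
  rewrite Rintegral_indic// nmulr_rge0; last by rewrite subr_lt0 ltr_rat.
  have := fine_ge0 (measure_ge0 P (E a b)) => h1 h2.
  have h0 : fine (P (E a b)) = 0 by apply/eqP; rewrite eq_le h2 h1.
  by rewrite -(fineK (fin_num_measure P _ (mE a b))) h0.
have : {ae P, forall x, forall p, [set p : rat * rat | p.1 < p.2] p -> ~ E p.1 p.2 x}.
  apply: ae_countable; first exact: countableP.
  move=> [a b] /= ab; exists (E a b); split; [exact: mE|exact: PE|].
  by move=> x /contrapT.
apply: filterS => x nE; apply: (@cvg_frequently _ _ M) => [n|a b ab]; first exact: AM.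
exact: (nE (a, b)).
Unshelve. all: by end_near. Qed.

End Birkhoff.

(** * Disintegration along a kernel *)

Section KernelDisintegration.
Local Open Scope ereal_scope.
Context {d : measure_display} {T : measurableType d} {R : realType}.
Variables (mu : probability T R) (k : T -> probability T R).
Hypothesis mk : forall B, measurable B -> measurable_fun setT (fun x => k x B).
Hypothesis muk : forall B, measurable B -> mu B = \int[mu]_x k x B.

Let kg : T -> giry T R := fun x => k x.

Let measurable_kg : measurable_fun setT kg.
Proof. by apply: measurable_giry_codensity => // B mB; exact: mk. Qed.

Let measurable_k (h : T -> \bar R) : measurable_fun setT h -> (forall x, 0 <= h x) ->
  measurable_fun setT (fun x => \int[k x]_y h y).
Proof.
move=> mh h0; exact: (measurableT_comp (measurable_giry_int mh h0) measurable_kg).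
Qed.

(** The hypothesis [muk] says that on measurable sets [mu] is the bind of [mu] with [k] in the Giry
    monad, and integration against a bind is iterated integration. *)
Let ge0_disintegration (h : T -> \bar R) : measurable_fun setT h -> (forall x, 0 <= h x) ->
  \int[mu]_x h x = \int[mu]_x \int[k x]_y h y.
Proof.
move=> mh h0; have := @giry_int_bind _ _ _ _ R (mu : giry T R) _ measurable_kg h mh h0.
rewrite /giry_int => <-; apply: eq_measure_integral => B mB _.
have mev : measurable_fun setT (@giry_ev d T R ^~ B) by exact: measurable_giry_ev.
have := giry_int_map measurable_kg (mu : giry T R) mev (fun x => measure_ge0 x B).
by rewrite /giry_int => E; rewrite [LHS](muk mB); exact: esym E.
Qed.

(** The nonnegative case applies to both parts of [f]. Applied to its absolute value, it gives an
    integrable function of [x], hence one that is finite almost everywhere: this is the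
    integrability under almost every [k x]. *)
Lemma integrable_disintegration (f : T -> R) : mu.-integrable setT (EFin \o f) ->
  [/\ {ae mu, forall x, (k x).-integrable setT (EFin \o f)},
      mu.-integrable setT (fun x => \int[k x]_y (f y)%:E) &
      \int[mu]_x (f x)%:E = \int[mu]_x \int[k x]_y (f y)%:E].
Proof.
move=> fi; have /integrableP[mf fley] := fi.
have mp : measurable_fun setT (EFin \o f)^\+ by exact: measurable_funepos.
have mn : measurable_fun setT (EFin \o f)^\- by exact: measurable_funeneg.
have ip := integrable_funepos measurableT fi.
have iN := integrable_funeneg measurableT fi.
have Jint h : measurable_fun setT h -> (forall x, 0 <= h x) -> mu.-integrable setT h ->
    mu.-integrable setT (fun x => \int[k x]_y h y).
  move=> mh h0 /integrableP[_ hi]; apply/integrableP; split; first exact: measurable_k.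
  under eq_integral => x _ do rewrite gee0_abs ?integral_ge0//.
  rewrite -ge0_disintegration//; apply: le_lt_trans hi.
  by apply: ge0_le_integral => //; [exact: measurableT_comp|move=> x _; exact: lee_abs].
have ipJ := Jint _ mp (fun x => funepos_ge0 _ x) ip.
have iNJ := Jint _ mn (fun x => funeneg_ge0 _ x) iN.
have kE x : \int[k x]_y (f y)%:E =
    \int[k x]_y (EFin \o f)^\+ y - \int[k x]_y (EFin \o f)^\- y by rewrite integralE.
split.
- have mabs : measurable_fun setT (fun x => `|(EFin \o f) x|) by exact: measurableT_comp.
  have iabs := Jint _ mabs (fun x => abse_ge0 _) (integrable_abse fi).
  have := integrable_ae measurableT iabs.
  apply: ae_impl => x /(_ I) kf; apply/integrableP; split => //.
  by rewrite -ge0_fin_numE//; exact: integral_ge0.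
- under eq_fun do rewrite kE; exact: integrableB.
- rewrite integralE (ge0_disintegration mp (fun x => funepos_ge0 _ x)).
  rewrite (ge0_disintegration mn (fun x => funeneg_ge0 _ x)) -integralB//.
  by apply: eq_integral => x _; rewrite kE.
Qed.

End KernelDisintegration.

(** * Time averages along the flow *)

(** If [y] is a cluster point of [h] at [z], every [phi] in [C] takes the same value at [y] and
    [h z], so [y = h z] by separation. In a compact space, a filter with a single cluster point
    converges to it. *)
Lemma separating_continuous (R : realType) (X : pmetricType R) (Z : topologicalType)
    (C : set (X -> R)) (h : Z -> X) : compact [set: X] -> smooth_structure C ->
  (forall phi, C phi -> continuous (phi \o h)) -> continuous h.
Proof.
move=> Xc sC ch z.
have cl y : cluster (h x @[x --> z]) y -> y = h z.
  move=> hy; apply: contrapT => yz.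
  have [phi Cphi phiyz] := smooth_separates sC yz.
  pose e := `|phi y - phi (h z)| / 2.
  have e0 : 0 < e by rewrite divr_gt0// normr_gt0 subr_eq0; apply/eqP.
  have e2 : e + e = `|phi y - phi (h z)| by rewrite -splitr.
  have cphi : continuous phi by exact: smooth_continuous sC _ Cphi.
  have /cvgrPdist_lt/(_ _ e0) A := ch phi Cphi z.
  have /cvgrPdist_lt/(_ _ e0) B := cphi y.
  have [x [/= Ax Bx]] := hy [set x | `|phi (h z) - phi x| < e] _ A B.
  have := ler_distD (phi x) (phi y) (phi (h z)).
  by rewrite -e2 [`|phi x - _|]distrC; lra.
apply: (@compact_cluster_set1 _ _ _ setT) => //.
- exact: metric_hausdorff.
- exact: filterT.
- exact: filterT.
- apply/seteqP; split => [y /cl ->//|_ ->].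
  have [//|y [_ hy]] := Xc (h x @[x --> z]) _ _; first exact: filterT.
  by rewrite -(cl y hy).
Qed.

Section FlowContinuity.
Variables (R : realType) (X : pmetricType R) (C : set (X -> R)).
Variables (mu : set X -> \bar R) (S : R -> X -> X) (F : forall x : X, tangent C x).
Hypothesis Xc : compact [set: X].
Hypothesis sC : smooth_structure C.
Hypothesis fS : measure_preserving_flow C mu S.
Hypothesis gS : generated_by S F.

Lemma flow_continuous t : continuous (S t).
Proof.
have [h [_ _ Ch]] := flow_diffeo fS t.
apply: (separating_continuous Xc sC) => phi Cphi.
by apply: (smooth_continuous sC); have [] := Ch phi Cphi.
Qed.

(** The vector field gives differentiability at time [0] only; at time [s] it is used at the point
    [S s x], through the group law. *)
Lemma orbit_continuous x : continuous (fun t => S t x).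
Proof.
apply: (separating_continuous Xc sC) => phi Cphi s.
have [dphi _] := gS (S s x) Cphi.
have /derivable1_diffP/differentiable_continuous c0 := dphi.
have -> : phi \o (fun t => S t x) = (fun t => phi (S t (S s x))) \o (fun t => t - s).
  by apply/funext => t /=; rewrite -[in LHS](subrK s t) (flowD fS).
apply: continuous_comp; first by apply: continuousB; [exact: cvg_id|exact: cst_continuous].
by rewrite /= subrr.
Qed.

End FlowContinuity.

(** Reduces continuity of an integral in a parameter to bounded convergence, which concerns
    sequences. *)
Lemma metric_seq_continuous (R : realType) (X : pmetricType R) (h : X -> R) :
  (forall (u : nat -> X) x, u n @[n --> \oo] --> x -> h (u n) @[n --> \oo] --> h x) ->
  continuous h.
Proof.
move=> hu x; apply/cvgrPdist_lt => e e0; apply: contrapT => nh.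
have /choice[u uP] : forall n, exists y, ball x n.+1%:R^-1 y /\ e <= `|h x - h y|.
  move=> n; apply: contrapT => /forallNP ny; apply: nh.
  apply/nbhs_ballP; exists n.+1%:R^-1 => /=; first by rewrite invr_gt0.
  by move=> y xy /=; rewrite ltNge; apply/negP => ey; apply: (ny y).
have ux : u n @[n --> \oo] --> x.
  apply/cvg_ballP => d d0; near=> n.
  apply: (@le_ball _ _ _ n.+1%:R^-1); last by have [] := uP n.
  near: n; have := @cvg_harmonic R => /cvgrPdist_le/(_ _ d0).
  by apply: filterS => n; rewrite sub0r normrN ger0_norm// invr_ge0.
have /cvgrPdist_lt/(_ _ e0)[N _ /(_ N (leqnn N))/=] := hu u x ux.
by rewrite ltNge; have [_ ->] := uP N.
Unshelve. all: by end_near. Qed.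

Lemma Rintegral_shift (R : realType) (G : R -> R) (a b : R) : 0 <= b -> continuous G ->
  \int[lebesgue_measure]_(t in `[a, a + b]) G t =
  \int[lebesgue_measure]_(t in `[0, b]) G (t + a).
Proof.
move=> b0 cG; rewrite /Rintegral; congr fine.
have dF (x : R) : is_derive x 1 (fun y : R => y + a) 1.
  by have := is_deriveD (is_derive_id x (1 : R)) (is_derive_cst a x (1 : R)); rewrite addr0.
have F' : derive1 (fun y : R => y + a) = cst 1.
  by apply/funext => x; rewrite derive1E; have [_ ->] := dF x.
have := @integration_by_substitution_increasing R (fun y => y + a) G 0 b b0.
rewrite F' add0r addrC => -> //.
- by apply: eq_integral => x _; rewrite /= mulr1.
- by move=> x y _ _ xy; rewrite ltrD2r.
- by move=> x _; exact: cst_continuous.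
- exact: is_cvg_cst.
- exact: is_cvg_cst.
- have cF : continuous (fun y : R => y + a).
    by move=> x; apply: continuousD; [exact: cvg_id|exact: cst_continuous].
  split; first by move=> x _; have [] := dF x.
  + by apply: cvg_at_right_filter; exact: cF.
  + by apply: cvg_at_left_filter; exact: cF.
- exact: continuous_subspaceT.
Qed.

(** Cauchy's criterion avoids the unknown limit and leaves countable quantifiers only. *)
Lemma measurable_cvgn d (T : measurableType d) (R : realType) (F : nat -> T -> R) :
  (forall n, measurable_fun setT (F n)) -> measurable [set x | cvgn (F ^~ x)].
Proof.
move=> mF.
rewrite (_ : mkset _ = \bigcap_k \bigcup_N \bigcap_(n in [set n | (N <= n)%N])
    ~` [set x | k.+1%:R^-1 < `|F N x - F n x|]).
  apply: bigcapT_measurable => k; apply: bigcupT_measurable => N.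
  apply: bigcap_measurable => [|n _]; first by exists N => /=.
  apply: measurableC.
  apply: (@measurable_gt _ _ _ (fun x => `|F N x - F n x|)).
  by apply: measurableT_comp => //; exact: measurable_funB.
apply/seteqP; split => x /=.
  move=> /cvg_ex[l /cvgrPdist_le Fl] k _.
  have e0 : 0 < k.+1%:R^-1 / 2 :> R by rewrite divr_gt0// invr_gt0.
  have [N _ FN] := Fl _ e0; exists N => // n /= Nn; apply/negP; rewrite -leNgt.
  rewrite (le_trans (ler_distD l _ _))// [leRHS]splitr lerD//; last exact: FN.
  by rewrite distrC; exact: (FN N (leqnn N)).
move=> Fx; apply/cauchy_cvgP/cauchy_exP => e e0.
have [k _ ke] : \forall k \near \oo, k.+1%:R^-1 < e.
  have := @cvg_harmonic R => /cvgrPdist_lt/(_ _ e0).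
  by apply: filterS => n; rewrite sub0r normrN ger0_norm// invr_ge0.
have [N _ FN] := Fx k I.
exists (F N x); exists N => // n /= Nn.
rewrite /ball/= (le_lt_trans _ (ke k (leqnn k)))// leNgt; apply/negP.
exact: FN.
Qed.

Lemma countable_bigcap_measurable d (T : measurableType d) (I : Type) (D : set I)
    (F : I -> set T) : countable D -> (forall i, D i -> measurable (F i)) ->
  measurable (\bigcap_(i in D) F i).
Proof.
move=> cD mF; have [->|/set0P D0] := eqVneq D set0; first by rewrite bigcap_set0.
have [e De eD] := countable_enum D0 cD.
rewrite (_ : bigcap _ _ = \bigcap_n F (e n)).
  by apply: bigcapT_measurable => n; exact: mF.
by apply/seteqP; split => [x Fx n _|x Fx i /eD[n <-]]; [exact: Fx|exact: Fx].
Qed.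

(** The supremum [sup_norm] bounds the values only if they are bounded; compactness ensures this. *)
Lemma dense_approx (R : realType) (X : pmetricType R) (D : set (X -> R)) :
  compact [set: X] -> dense_in_continuous D -> forall f, continuous f ->
  forall e, 0 < e -> exists2 g, D g & forall x, `|f x - g x| <= e.
Proof.
move=> Xc [Dc Dd] f cf e e0; have [g Dg fge] := Dd f cf e e0.
exists g => // x; rewrite (le_trans _ (ltW fge))//.
have [M _ fgM] := continuous_bounded Xc (continuous_subf cf (Dc g Dg)).
apply: ub_le_sup; last by exists x.
by exists M => _ [y _ <-]; exact: fgM.
Qed.

(** * Averages over the orbits of a continuous flow *)

Section TimeAverages.
Variables (R : realType) (X : pmetricType R) (S : R -> X -> X).
Hypothesis Xc : compact [set: X].
Hypothesis S0 : S 0 = id.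
Hypothesis SD : forall t s, S (t + s) = S t \o S s.
Hypothesis S_continuous : forall t, continuous (S t).
Hypothesis S_orbit : forall x, continuous (fun t => S t x).
Implicit Types (f g : X -> R) (x : X) (a b t s T M : R).

Local Notation leb := (@lebesgue_measure R).

Definition time_integral f x a : R := \int[leb]_(t in `[0, a]) f (S t x).
Local Notation I := time_integral.

Let orbit_continuousf f x : continuous f -> continuous (fun t => f (S t x)).
Proof. by move=> cf t; apply: continuous_comp; [exact: S_orbit|exact: cf]. Qed.

Let leb_lty a b : (leb `[a, b]%classic < +oo)%E.
Proof. by rewrite lebesgue_measure_itv/=; case: ifPn => _; rewrite ltry. Qed.

Let orbit_measurable f x D : continuous f -> measurable D ->
  measurable_fun D (fun t => f (S t x)).
Proof.
move=> cf mD; apply: measurable_funTS; apply: continuous_measurable_fun.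
exact: orbit_continuousf.
Qed.

Let orbit_integrable f x a b : continuous f ->
  leb.-integrable `[a, b] (EFin \o (fun t => f (S t x))).
Proof.
move=> cf; have [M _ fM] := continuous_bounded Xc cf.
apply: (@bounded_integrable _ _ _ _ _ _ M) => //; first exact: leb_lty.
exact: orbit_measurable.
Qed.

Lemma time_integralD f x a b : continuous f -> 0 <= a -> 0 <= b ->
  I f x (a + b) = I f x a + I f (S a x) b.
Proof.
move=> cf a0 b0.
suff : I f x (a + b) - I f x a = I f (S a x) b by move=> <-; rewrite [RHS]addrC subrK.
rewrite /I Rintegral_itvB; last 3 first.
- exact: orbit_integrable.
- by rewrite bnd_simp.
- by rewrite bnd_simp lerDl.
rewrite Rintegral_itv_obnd_cbnd; last first.
  apply: integrableS (orbit_integrable x a (a + b) cf) => //.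
  exact: subset_itv_oc_cc.
rewrite Rintegral_shift//; last exact: orbit_continuousf.
by apply: eq_Rintegral => t _; rewrite SD.
Qed.

Lemma time_integral_bound f x a M : continuous f -> 0 <= a ->
  (forall x, `|f x| <= M) -> `|I f x a| <= M * a.
Proof.
move=> cf a0 fM.
have := @Rintegral_le_bound _ _ _ leb `[0, a]%classic (fun t => f (S t x)) M.
rewrite /= lebesgue_measure_itv/= lte_fin sube0.
case: ifPn => [_|] /=; first by apply => //; [exact: ltry|exact: orbit_measurable].
rewrite -leNgt => a0' _; have -> : a = 0 by apply/eqP; rewrite eq_le a0 a0'.
by rewrite /I set_itv1 Rintegral_set1 normr0 mulr0.
Qed.

Lemma time_integral_add f g x a : continuous f -> continuous g ->
  I (fun y => f y + g y) x a = I f x a + I g x a.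
Proof. by move=> cf cg; rewrite /I RintegralD//; exact: orbit_integrable. Qed.

Lemma time_integral_scale c f x a : continuous f ->
  I (fun y => c * f y) x a = c * I f x a.
Proof. by move=> cf; rewrite /I RintegralZl//; exact: orbit_integrable. Qed.

Lemma time_integral_cst c x a : 0 <= a -> I (fun=> c) x a = c * a.
Proof.
rewrite /I Rintegral_cst//= lebesgue_measure_itv/= lte_fin sube0.
by rewrite le_eqVlt => /predU1P[<-|->]; rewrite ?ltxx.
Qed.

Lemma time_integral_sub f g x a : continuous f -> continuous g ->
  I (fun y => f y - g y) x a = I f x a - I g x a.
Proof. by move=> cf cg; rewrite /I RintegralB//; exact: orbit_integrable. Qed.

Lemma time_integral_ge0 f x a : (forall x, 0 <= f x) -> 0 <= I f x a.
Proof. by move=> f0; apply: Rintegral_ge0 => t _. Qed.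

Lemma time_integral_comp f x a s : I (f \o S s) x a = I f (S s x) a.
Proof.
apply: eq_Rintegral => t _ /=.
by rewrite -[S s (S t x)]/((S s \o S t) x) -SD addrC SD.
Qed.

Lemma time_integral_continuous f a : continuous f -> continuous (I f ^~ a).
Proof.
move=> cf; have [M _ fM] := continuous_bounded Xc cf.
apply: metric_seq_continuous => u x ux.
apply: (@bounded_convergence _ _ _ _ _ _ _ M) => //.
- exact: leb_lty.
- by move=> n; exact: orbit_measurable.
- move=> t _; apply: (cvg_comp u (fun y => f (S t y)) ux).
  by apply: continuous_comp; [exact: S_continuous|exact: cf].
Qed.

Section Invariant.
Variable P : probability (borel X) R.
Hypothesis SP : preserves S P.

Lemma Rintegral_flow t (f : borel X -> R) : bounded_measurable f ->
  \int[P]_x f (S t x) = \int[P]_x f x.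
Proof.
move=> bf; apply: (@Rintegral_comp _ _ _ P (S t)) => //.
  by apply: continuous_comp_borel; exact: S_continuous.
by move=> B; exact: SP.
Qed.

(* No Fubini: [a |-> \int (w * I f x a) dP] is additive, hence equals [n] times
   its value at [a / n], and [I f x s = s * f x + o(s)] as [s] tends to [0]. *)
Lemma Rintegral_time_integral w f a : bounded_measurable (w : borel X -> R) ->
  (forall t x, w (S t x) = w x) -> continuous f -> 0 <= a ->
  \int[P]_x (w x * I f x a) = a * \int[P]_x (w x * f x).
Proof.
move=> bw wS cf a0; have [M M0 fM] := continuous_bounded Xc cf.
have [W wW] := bw.2.
have bI s : bounded_measurable (fun x : borel X => w x * I f x s).
  apply: bounded_measurableM => //.
  by apply: continuous_bounded_measurable => //; exact: time_integral_continuous.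
have bi := bounded_measurable_integrable P.
pose h s := \int[P]_x (w x * I f x s).
(* The integral up to [s + t] splits at time [s]; invariance of [P] and of [w] moves the starting
   point of the second piece from [S s x] back to [x]. *)
have hD s t : 0 <= s -> 0 <= t -> h (s + t) = h s + h t.
  move=> s0 t0; rewrite /h -(Rintegral_flow s (bI t)) -RintegralD//.
  - by apply: eq_Rintegral => x _; rewrite time_integralD// wS mulrDr.
  - exact: bi.
  - apply: bi; apply: bounded_measurable_comp (bI t).
    by apply: continuous_comp_borel; exact: S_continuous.
have hn n s : 0 <= s -> h (n.+1%:R * s) = n.+1%:R * h s.
  move=> s0; elim: n => [|n IH]; first by rewrite !mul1r.
  by rewrite -natr1 mulrDl mul1r hD// ?mulr_ge0// IH mulrDl mul1r.
pose G n x := n.+1%:R * (w x * I f x (a / n.+1%:R)).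
have hG n : \int[P]_x G n x = h a.
  rewrite RintegralZl//; last exact: bi.
  have an0 : 0 <= a / n.+1%:R by rewrite divr_ge0.
  rewrite -[LHS](hn n _ an0); congr h.
  by rewrite mulrCA divff ?mulr1// pnatr_eq0.
have cv : \int[P]_x G n x @[n --> \oo] --> \int[P]_x (a * (w x * f x)).
  apply: (@bounded_convergence _ _ _ _ _ _ _ (W * (M * a))) => //.
  - exact: probability_lty.
  - by move=> n; apply: measurable_funM => //; have [] := bI (a / n.+1%:R).
  - move=> n x _; rewrite /G mulrCA normrM ler_pM//.
    rewrite normrM normr_nat mulrC -ler_pdivlMr ?ltr0n// -mulrA.
    by apply: time_integral_bound => //; rewrite divr_ge0.
  - move=> x _.
    suff : n.+1%:R * I f x (a / n.+1%:R) @[n --> \oo] --> a * f x.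
      move=> /(cvgM (cvg_cst (w x))); rewrite mulrCA; apply: cvg_trans.
      by apply: near_eq_cvg; apply: nearW => n; rewrite /G mulrCA.
    apply/cvgrPdist_le => e e0.
    (* The denominator is [a + 1] rather than [a] so that [a = 0] is allowed; in the end only
       [e' * a <= e] matters. *)
    pose e' := e / (a + 1).
    have a1 : 0 < a + 1 by rewrite ltr_wpDl.
    have e'0 : 0 < e' by rewrite divr_gt0.
    have cfx : {for 0, continuous (fun t => f (S t x))} by exact: orbit_continuousf.
    have /cvgrPdist_le/(_ _ e'0)/nbhs_ballP[d /= d0 fd] := cfx.
    near=> n.
    have an : a / n.+1%:R < d.
      rewrite ltr_pdivrMr ?ltr0n// mulrC -ltr_pdivrMr//.
      rewrite (@lt_le_trans _ _ n%:R) ?ler_nat//; near: n; exact: nbhs_infty_gtr.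
    have an0 : 0 <= a / n.+1%:R by rewrite divr_ge0.
    have : `|I (fun y => f y - f x) x (a / n.+1%:R)| <= e' * (a / n.+1%:R).
      have := @Rintegral_le_bound _ _ _ leb `[0, a / n.+1%:R]%classic
        (fun t => f (S t x) - f x) e'.
      rewrite /= lebesgue_measure_itv/= lte_fin sube0.
      case: ifPn => [_|] /=.
        apply => //; first exact: ltry.
          by apply: measurable_funB => //; exact: orbit_measurable.
        move=> t; rewrite /= in_itv/= => /andP[t0 tn].
        rewrite distrC; have := fd t; rewrite S0; apply.
        by rewrite /ball/= sub0r normrN ger0_norm// (le_lt_trans tn).
      rewrite -leNgt => an0' _; have -> : a / n.+1%:R = 0 by apply/eqP; rewrite eq_le an0 an0'.
      by rewrite /I set_itv1 Rintegral_set1 normr0 mulr0.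
    rewrite time_integral_sub//; last exact: continuous_cstf.
    rewrite time_integral_cst// => Ie.
    rewrite distrC (_ : _ - a * f x = n.+1%:R * (I f x (a / n.+1%:R) - f x * (a / n.+1%:R))).
      rewrite normrM normr_nat mulrC -ler_pdivlMr ?ltr0n// (le_trans Ie)//.
      rewrite mulrA ler_wpM2r ?invr_ge0// /e' -mulrA ler_piMr ?(ltW e0)//.
      by rewrite mulrC ler_pdivrMr// mul1r lerDl.
    by rewrite mulrBr; congr (_ - _); field.
rewrite -/(h a) -RintegralZl//; last first.
  apply: bi; apply: bounded_measurableM => //.
  exact: continuous_bounded_measurable.
apply: (cvg_unique (@Rhausdorff R) _ cv).
rewrite (_ : (fun n => _) = fun=> h a); first exact: cvg_cst.
by apply/funext => n; exact: hG.
Unshelve. all: by end_near. Qed.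

End Invariant.

Local Notation Sigma := (regular_points S).

Let averageE f x T : average S f x T = T^-1 * I f x T.
Proof. by []. Qed.

Lemma average_bound f x T M : continuous f -> 0 <= T -> (forall x, `|f x| <= M) ->
  `|average S f x T| <= M.
Proof.
move=> cf T0 fM; have M0 : 0 <= M by rewrite (le_trans _ (fM x)).
move: T0; rewrite le_eqVlt => /predU1P[<-|T0].
  by rewrite /average invr0 mul0r normr0.
rewrite /average normrM normfV (gtr0_norm T0) mulrC ler_pdivrMr//.
by apply: (time_integral_bound) => //; exact: ltW.
Qed.

Lemma average_sub f g x T : continuous f -> continuous g ->
  average S (fun y => f y - g y) x T = average S f x T - average S g x T.
Proof. by move=> cf cg; rewrite /average -mulrBr -time_integral_sub. Qed.

(** Write [T = n + r] with [n] the integer part. If [f] is bounded by [M], the averages up to [n]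
    and up to [T] differ by at most [2 * M / T]. *)
Lemma average_cvg_nat f x (l : R) : continuous f ->
  average S f x n%:R @[n --> \oo] --> l -> average S f x T @[T --> +oo] --> l.
Proof.
move=> cf fl; have [M M0 fM] := continuous_bounded Xc cf.
apply/cvgrPdist_le => e e0.
have e2 : 0 < e / 2 by rewrite divr_gt0.
have /cvgrPdist_le/(_ _ e2)[N _ fN] := fl.
near=> T.
have T0 : 0 < T by near: T; exact: nbhs_pinfty_gt.
have T0' := ltW T0.
pose n := Num.truncn T; pose r := T - n%:R.
have /andP[nT Tn] := truncn_itv T0'.
have r0 : 0 <= r by rewrite subr_ge0.
have r1 : r <= 1 by rewrite lerBlDl -natr1 in Tn *; rewrite ltW.
have TE : T = n%:R + r by rewrite /r addrC subrK.
have Nn : (N <= n)%N.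
  by rewrite truncn_ge_nat//; near: T; exact: nbhs_pinfty_ge.
suff H : `|average S f x n%:R - average S f x T| <= e / 2.
  by rewrite (le_trans (ler_distD (average S f x n%:R) _ _))// [leRHS]splitr lerD// fN.
have TI : I f x T = I f x n%:R + I f (S n%:R x) r.
  by rewrite {1}TE (time_integralD).
have -> : average S f x n%:R - average S f x T =
    T^-1 * (r * average S f x n%:R - I f (S n%:R x) r).
  have nI : n%:R * average S f x n%:R = I f x n%:R.
    rewrite /average; have [n0|n0] := eqVneq (n%:R : R) 0.
      by rewrite n0 mul0r /I set_itv1 Rintegral_set1.
    by rewrite mulrA divff// mul1r.
  rewrite [average S f x T]averageE TI -nI.
  rewrite -[X in X - _](mulKf (lt0r_neq0 T0)) -mulrBr; congr (_ * _).
  by rewrite {1}TE; ring.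
rewrite normrM normfV (gtr0_norm T0) mulrC ler_pdivrMr//.
apply: (@le_trans _ _ (M + M)); last first.
  by rewrite mulrC -ler_pdivrMr//; near: T; exact: nbhs_pinfty_ge.
rewrite (le_trans (ler_normB _ _))// lerD//.
  rewrite normrM (ger0_norm r0) -[leRHS]mul1r ler_pM//.
  exact: average_bound.
rewrite (le_trans (time_integral_bound _ cf r0 fM))//.
by rewrite ler_piMr// ltW.
Unshelve. all: by end_near. Qed.

Lemma average_cvgE f x : continuous f ->
  cvg (average S f x T @[T --> +oo]) <-> cvgn (fun n => average S f x n%:R).
Proof.
move=> cf; split=> /cvg_ex[l fl]; apply/cvg_ex; exists l; last exact: average_cvg_nat.
exact: (cvg_comp _ _ (@cvgr_idn R) fl).
Qed.

Lemma time_averageP f x : Sigma x -> continuous f ->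
  average S f x n%:R @[n --> \oo] --> time_average S f x.
Proof. by move=> Sx cf; apply: (cvg_comp _ _ (@cvgr_idn R)); exact: Sx. Qed.

Lemma time_averageE f x (l : R) : continuous f ->
  average S f x n%:R @[n --> \oo] --> l -> time_average S f x = l.
Proof.
by move=> cf fl; apply: cvg_lim => //; exact: average_cvg_nat.
Qed.

Lemma time_averageD f g x : Sigma x -> continuous f -> continuous g ->
  time_average S (fun y => f y + g y) x = time_average S f x + time_average S g x.
Proof.
move=> Sx cf cg; apply: time_averageE; first exact: continuous_addf.
apply: cvg_trans (cvgD (time_averageP Sx cf) (time_averageP Sx cg)).
apply: near_eq_cvg; apply: nearW => n /=.
by rewrite !fctE !averageE time_integral_add// mulrDr.
Qed.

Lemma time_averageZ a f x : Sigma x -> continuous f ->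
  time_average S (fun y => a * f y) x = a * time_average S f x.
Proof.
move=> Sx cf; apply: time_averageE; first exact: continuous_scalef.
apply: cvg_trans (cvgM (cvg_cst a) (time_averageP Sx cf)); apply: near_eq_cvg; apply: nearW => n /=.
by rewrite !averageE time_integral_scale// mulrCA.
Qed.

Lemma time_average_cst a x : time_average S (fun=> a) x = a.
Proof.
apply: time_averageE; first exact: continuous_cstf.
apply: cvg_near_cst; exists 1%N => // n /= n0.
rewrite averageE time_integral_cst// mulrC mulfK//.
by rewrite pnatr_eq0 -lt0n.
Qed.

Lemma time_average_ge0 f x : Sigma x -> continuous f -> (forall x, 0 <= f x) ->
  0 <= time_average S f x.
Proof.
move=> Sx cf f0; apply: (cvgr_to_ge (time_averageP Sx cf)); apply: nearW => n.
by rewrite /average mulr_ge0// ?invr_ge0//; exact: time_integral_ge0.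
Qed.

Lemma time_average_le f g x e : Sigma x -> continuous f -> continuous g ->
  (forall y, `|f y - g y| <= e) ->
  `|time_average S f x - time_average S g x| <= e.
Proof.
move=> Sx cf cg fge.
apply: (cvgr_to_le (cvg_norm (cvgB (time_averageP Sx cf) (time_averageP Sx cg)))).
apply: nearW => n /=; rewrite !fctE -average_sub//.
by apply: average_bound => //; exact: continuous_subf.
Qed.

(** Splitting the integral up to [n + s] at [s] and at [n] shows that the integrals up to [n] from
    [x] and from [S s x] differ by two integrals of length [s], which are bounded independently of
    [n]. *)
Lemma average_flow f x s (l : R) : continuous f -> 0 <= s ->
  (average S f x n%:R @[n --> \oo] --> l) <-> (average S f (S s x) n%:R @[n --> \oo] --> l).
Proof.
move=> cf s0; have [M M0 fM] := continuous_bounded Xc cf.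
suff H : (average S f (S s x) n%:R - average S f x n%:R) @[n --> \oo] --> (0 : R).
  split=> h.
    rewrite -[l]addr0; apply: cvg_trans (cvgD h H); apply: near_eq_cvg.
    by apply: nearW => n /=; rewrite !fctE addrC subrK.
  rewrite -[l]subr0; apply: cvg_trans (cvgB h H); apply: near_eq_cvg.
  by apply: nearW => n /=; rewrite !fctE opprB addrC subrK.
apply/cvgrPdist_le => e e0; near=> n; rewrite sub0r normrN.
have n0 : 0 < n%:R :> R by rewrite ltr0n; near: n; exact: nbhs_infty_gt.
have E1 := time_integralD x cf s0 (ltW n0).
have E2 := time_integralD x cf (ltW n0) s0.
rewrite !averageE -mulrBr normrM normfV (gtr0_norm n0) mulrC ler_pdivrMr//.
have B1 := time_integral_bound x cf s0 fM.
have B2 := time_integral_bound (S n%:R x) cf s0 fM.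
rewrite (_ : _ - _ = I f (S n%:R x) s - I f x s); last first.
  by rewrite addrC E2 in E1; lra.
rewrite (le_trans (ler_normB _ _))// (le_trans (lerD B2 B1))//.
rewrite -ler_pdivrMl//; near: n; exact: nbhs_infty_ger.
Unshelve. all: by end_near. Qed.

Lemma average_flowP f x s (l : R) : continuous f ->
  (average S f x n%:R @[n --> \oo] --> l) <-> (average S f (S s x) n%:R @[n --> \oo] --> l).
Proof.
move=> cf; have [s0|s0] := leP 0 s; first exact: average_flow.
have s0' : 0 <= - s by rewrite oppr_ge0 ltW.
have := average_flow (S s x) l cf s0'.
by rewrite -[S (- s) (S s x)]/((S (- s) \o S s) x) -SD addNr S0 => -[? ?]; split.
Qed.

Lemma regular_flow s x : Sigma (S s x) <-> Sigma x.
Proof.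
have [h1 h2] : (forall f (l : R), continuous f -> (average S f x n%:R @[n --> \oo] --> l) ->
      average S f (S s x) n%:R @[n --> \oo] --> l) /\
    (forall f (l : R), continuous f -> (average S f (S s x) n%:R @[n --> \oo] --> l) ->
      average S f x n%:R @[n --> \oo] --> l).
  by split=> f l cf; case: (average_flowP x s l cf).
split=> Sx f cf; have /(average_cvgE _ cf)/cvg_ex[l fl] := Sx f cf;
  apply/(average_cvgE _ cf)/cvg_ex; exists l; [exact: h2|exact: h1].
Qed.

Lemma time_average_flow f s x : Sigma x -> continuous f ->
  time_average S f (S s x) = time_average S f x.
Proof.
move=> Sx cf; apply: time_averageE => //.
by have [+ _] := average_flowP x s (time_average S f x) cf; apply; exact: time_averageP.
Qed.

Lemma time_average_comp f s x : Sigma x -> continuous f ->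
  time_average S (f \o S s) x = time_average S f x.
Proof.
move=> Sx cf; rewrite -(time_average_flow s Sx cf) /time_average.
rewrite (_ : average S (f \o S s) x = average S f (S s x))//.
by apply/funext => T; rewrite !averageE time_integral_comp.
Qed.

(** * Regular points and invariant measures *)

Section Dense.
Variable D : set (X -> R).
Hypothesis D_countable : countable D.
Hypothesis D_dense : dense_in_continuous D.

(** This makes the set of regular points a countable intersection, hence Borel. *)
Lemma regular_dense x :
  (forall f, D f -> cvg (average S f x T @[T --> +oo])) -> Sigma x.
Proof.
move=> Dx f cf; apply/average_cvgE => //; apply/cauchy_cvgP/cauchy_exP => e e0.
have e3 : 0 < e / 3 by rewrite divr_gt0.
have [g Dg fg] := dense_approx Xc D_dense cf e3.
have cg : continuous g by exact: D_dense.1.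
have /(average_cvgE _ cg)/cvg_ex[l /cvgrPdist_lt/(_ _ e3) gl] := Dx g Dg.
(* Cauchy's criterion asks for some ball of radius [e]; its centre is the limit for the
   approximation [g], not for [f]. *)
exists l; suff : \forall n \near \oo, `|l - average S f x n%:R| < e by [].
near=> n.
rewrite (le_lt_trans (ler_distD (average S g x n%:R) _ _))//.
rewrite (_ : e = e / 3 + 2 * (e / 3)); last by field.
rewrite ltr_leD//; first by near: n.
rewrite distrC -average_sub// (@le_trans _ _ (e / 3))//; last by lra.
by apply: average_bound => //; exact: continuous_subf.
Unshelve. all: by end_near. Qed.

Lemma time_average_dense x y : Sigma x -> Sigma y ->
  (forall f, D f -> time_average S f x = time_average S f y) ->
  forall f, continuous f -> time_average S f x = time_average S f y.
Proof.
move=> Sx Sy xy f cf; apply/eqP; rewrite -subr_eq0 -normr_le0.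
apply/ler_addgt0Pl => e e0; rewrite addr0.
have e2 : 0 < e / 2 by rewrite divr_gt0.
have [g Dg fg] := dense_approx Xc D_dense cf e2.
have cg : continuous g by exact: D_dense.1.
have := time_average_le Sx cf cg fg; have := time_average_le Sy cf cg fg.
rewrite (xy g Dg) distrC => h1 h2.
by rewrite (le_trans (ler_distD (time_average S g y) _ _))// [leRHS]splitr lerD.
Qed.

Lemma regularE : Sigma =
  \bigcap_(f in D) [set x | cvgn (fun n => average S f x n%:R)].
Proof.
apply/seteqP; split => x Sx.
  move=> f Df; have cf : continuous f by exact: D_dense.1.
  by have [+ _] := average_cvgE x cf; apply; exact: Sx.
apply: regular_dense => f Df; have cf : continuous f by exact: D_dense.1.
by have [_ +] := average_cvgE x cf; apply; exact: Sx.
Qed.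

Lemma average_continuous f n : continuous f -> continuous (fun x => average S f x n%:R).
Proof.
by move=> cf; apply: continuous_scalef; exact: time_integral_continuous.
Qed.

Lemma measurable_regular : measurable (Sigma : set (borel X)).
Proof.
rewrite regularE; apply: countable_bigcap_measurable => // f Df.
apply: (@measurable_cvgn _ (borel X)) => n; apply: continuous_borel.
by apply: average_continuous; exact: D_dense.1.
Qed.

(** At an irregular point [time_average] may be the default value of a limit that does not exist.
    With the indicator, the function is everywhere a limit of measurable functions. *)
Definition regular_average f x := \1_Sigma x * time_average S f x.

Lemma regular_averageE f x : Sigma x -> regular_average f x = time_average S f x.
Proof. by move=> Sx; rewrite /regular_average indicE mem_set// mul1r. Qed.

Lemma regular_averageP f x : continuous f ->
  \1_Sigma x * average S f x n%:R @[n --> \oo] --> regular_average f x.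
Proof.
move=> cf; rewrite /regular_average indicE.
have [Sx|nSx] := pselect (Sigma x).
  by rewrite mem_set//; apply: cvgM; [exact: cvg_cst|exact: time_averageP].
rewrite memNset// mul0r; apply: cvg_near_cst; apply: nearW => n.
by rewrite mul0r.
Qed.

Let average_regular_bound f M n x : continuous f -> (forall x, `|f x| <= M) ->
  `|\1_Sigma x * average S f x n%:R| <= M.
Proof.
move=> cf fM; rewrite normrM -[leRHS]mul1r ler_pM//; first exact: indic_le1.
exact: average_bound.
Qed.

Let average_regular_measurable f n : continuous f ->
  measurable_fun [set: borel X] (fun x : borel X => \1_Sigma x * average S f x n%:R).
Proof.
move=> cf; apply: measurable_funM.
  by apply: measurable_indic; exact: measurable_regular.
by apply: continuous_borel; exact: average_continuous.
Qed.

Lemma bounded_measurable_regular_average f : continuous f ->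
  bounded_measurable (regular_average f : borel X -> R).
Proof.
move=> cf; have [M _ fM] := continuous_bounded Xc cf.
apply: (@bounded_measurable_cvg _ (borel X) R
  (fun n x => \1_Sigma x * average S f x n%:R) _ M).
- by move=> n; exact: average_regular_measurable.
- by move=> n x; exact: average_regular_bound.
- by move=> x; exact: regular_averageP.
Qed.

Section Invariant.
Variable P : probability (borel X) R.
Hypothesis SP : preserves S P.

(** The integral of [f] over [[0, n]] along the orbit of [x] is the [n]-th ergodic sum, under [S 1],
    of the integral over [[0, 1]]; Birkhoff's theorem then applies to each of the countably many [f]
    in [D]. *)
Lemma ae_regular : {ae P, forall x, Sigma x}.
Proof.
rewrite regularE; apply: ae_countable => // f Df.
have cf : continuous f by exact: D_dense.1.
have mS1 : measurable_fun setT (S 1 : borel X -> borel X).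
  by apply: continuous_comp_borel; exact: S_continuous.
have bI : bounded_measurable (I f ^~ 1 : borel X -> R).
  by apply: continuous_bounded_measurable => //; exact: time_integral_continuous.
have IE n x : I f x n%:R = @ergodic_sum _ (borel X) R (S 1) (I f ^~ 1) n x.
  elim: n x => [|n IH] x.
    by rewrite /ergodic_sum big_ord0 /I set_itv1 Rintegral_set1.
  by rewrite ergodic_sumS -IH -natr1 addrC time_integralD.
have PS1 (B : set (borel X)) : measurable B -> P (S 1 @^-1` B) = P B by exact: SP.
have := (@birkhoff _ (borel X) R P (S 1) mS1 PS1 (I f ^~ 1) bI).
apply: ae_impl => x; rewrite (_ : (fun n => _) = fun n => average S f x n%:R)//.
by apply/funext => n; rewrite averageE IE.
Qed.

Lemma regular_full : P (~` Sigma) = 0%E.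
Proof.
have [N [mN PN SN]] := ae_regular.
by apply: (subset_measure0 _ mN SN PN); apply: measurableC; exact: measurable_regular.
Qed.

Lemma Rintegral_regular_average f : continuous f ->
  \int[P]_x regular_average f x = \int[P]_x f x.
Proof.
move=> cf; have [M _ fM] := continuous_bounded Xc cf.
have cv : \int[P]_x (\1_Sigma x * average S f x n%:R) @[n --> \oo] -->
    \int[P]_x regular_average f x.
  apply: (@bounded_convergence _ (borel X) _ _ _ _ _ M) => //.
  - exact: probability_lty.
  - by move=> n; exact: average_regular_measurable.
  - by move=> n x _; exact: average_regular_bound.
  - by move=> x _; exact: regular_averageP.
apply: (cvg_unique (@Rhausdorff R) cv).
(* From index [1] on, the sequence of integrals is constant. At index [0] the average is [0]. *)
apply: cvg_near_cst; exists 1%N => // n /= n0.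
transitivity (\int[P]_x average S f x n%:R).
  congr fine; apply: ae_eq_integral => //.
  - by apply/measurable_EFinP; exact: average_regular_measurable.
  - by apply/measurable_EFinP; apply: continuous_borel; exact: average_continuous.
  - apply: ae_impl ae_regular => x Sx _.
    by rewrite indicE mem_set// mul1r.
have n1 : 0 < n%:R :> R by rewrite ltr0n.
have b1 : bounded_measurable (fun _ : borel X => 1 : R) by exact: bounded_measurable_cst.
have := @Rintegral_time_integral P SP (fun=> 1) f n%:R b1 (fun _ _ => erefl) cf (ltW n1).
under eq_Rintegral do rewrite mul1r; under [in X in _ = X -> _]eq_Rintegral do rewrite mul1r.
move=> E; rewrite /average RintegralZl//; last first.
  apply: bounded_measurable_integrable; apply: continuous_bounded_measurable => //.
  exact: time_integral_continuous.
by rewrite [X in _ * X]E mulKf// gt_eqF.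
Qed.

End Invariant.


Let D_continuous f : D f -> continuous f.
Proof. by move=> Df; exact: D_dense.1. Qed.

(** * The ergodic decomposition *)

Variable mu : probability (borel X) R.
Hypothesis Smu : preserves S mu.

Lemma time_average_measures : exists k : X -> probability (borel X) R,
  (forall x f, Sigma x -> continuous f -> \int[k x]_y f y = time_average S f x) /\
  (forall x, ~ Sigma x -> k x = mu).
Proof.
suff /choice[k kP] : forall x, exists P : probability (borel X) R,
    (forall f, Sigma x -> continuous f -> \int[P]_y f y = time_average S f x) /\
    (~ Sigma x -> P = mu).
  by exists k; split => [x f|x]; have [h1 h2] := kP x; [exact: h1|exact: h2].
(* A constant choice at irregular points keeps the dependence on [x] measurable. *)
move=> x; have [Sx|nSx] := pselect (Sigma x); last by exists mu.
have [f g|a f|f cf f0||P PE] := @riesz_representation R X Xc (fun f => time_average S f x).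
- exact: time_averageD.
- exact: time_averageZ.
- exact: time_average_ge0.
- exact: time_average_cst.
- by exists P; split => // f _; exact: PE.
Qed.

Section Decomposition.
Variable k : X -> probability (borel X) R.
Hypothesis k_regular : forall x f, Sigma x -> continuous f ->
  \int[k x]_y f y = time_average S f x.
Hypothesis k_irregular : forall x, ~ Sigma x -> k x = mu.

Local Notation reg := regular_average.

Let bi := @bounded_measurable_integrable _ (borel X) R.

(** At a regular point, [f] and [f \o S t] have the same time average, so [k x] and its image under
    [S t] agree on continuous functions. *)
Lemma k_preserves x : Sigma x -> preserves S (k x).
Proof.
move=> Sx t B mB.
have bB : bounded_measurable (\1_B : borel X -> R) by exact: bounded_measurable_indic.
have mSt : measurable_fun setT (S t : borel X -> borel X).
  by apply: continuous_comp_borel; exact: S_continuous.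
have := @Rintegral_unique R X (k x) (k x) (fun=> 1) (S t) 1 Xc
  (bounded_measurable_cst 1) mSt _ _ bB.
rewrite mul1r Rintegral_indic//.
rewrite (@eq_Rintegral _ _ _ _ _ (\1_(S t @^-1` B) : borel X -> R)); last first.
  by move=> y _; rewrite mul1r.
have mtB : measurable (S t @^-1` B : set (borel X)).
  by rewrite -[X in measurable X]setTI; exact: mSt.
rewrite Rintegral_indic// => kB.
rewrite -(fineK (fin_num_measure (k x) _ mtB)) kB ?fineK// ?fin_num_measure//.
move=> f cf; rewrite mul1r (k_regular Sx cf) -(time_average_comp t Sx cf) -k_regular//.
  by apply: eq_Rintegral => y _; rewrite mul1r.
by move=> y; apply: continuous_comp; [exact: S_continuous|exact: cf].
Qed.

Let k_continuous x f : continuous f -> \int[k x]_y f y =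
  reg f x + \1_(~` Sigma) x * \int[mu]_y f y.
Proof.
move=> cf; rewrite indicE; have [Sx|nSx] := pselect (Sigma x).
  by rewrite k_regular// regular_averageE// memNset ?mul0r ?addr0//; exact.
by rewrite k_irregular// mem_set// mul1r /regular_average indicE memNset// mul0r add0r.
Qed.

Let Rintegral_k_bound f M x : bounded_measurable (f : borel X -> R) -> (forall y, `|f y| <= M) ->
  `|\int[k x]_y f y| <= M.
Proof.
move=> [mf _] fM; have := @Rintegral_le_bound _ _ _ (k x) setT f M measurableT
  (probability_lty _ measurableT) mf (fun y _ => fM y).
by rewrite [X in fine X](probability_setT (k x)) mulr1.
Qed.

Let bounded_k f : bounded_measurable (f : borel X -> R) ->
  measurable_fun [set: borel X] (fun x => \int[k x]_y f y) ->
  bounded_measurable (fun x : borel X => \int[k x]_y f y).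
Proof.
by move=> bf mf; split => //; have [M fM] := bf.2; exists M => x; exact: Rintegral_k_bound.
Qed.

(** For continuous [f] the inner integral is [reg f x] plus a constant supported on the negligible
    set of irregular points. Measurability is proved together with the identity since the outer
    integral of a sum or a multiple requires it. *)
Lemma disintegration f : bounded_measurable (f : borel X -> R) ->
  measurable_fun [set: borel X] (fun x => \int[k x]_y f y) /\
  \int[mu]_x \int[k x]_y f y = \int[mu]_x f x.
Proof.
move: f; apply: (@bounded_monotone_class R X) => //.
- move=> f cf.
  have breg : bounded_measurable (reg f : borel X -> R).
    exact: bounded_measurable_regular_average.
  have bS : bounded_measurable (\1_(~` Sigma) : borel X -> R).
    by apply: bounded_measurable_indic; apply: measurableC; exact: measurable_regular.
  have kE : (fun x => \int[k x]_y f y) = fun x => reg f x + \int[mu]_y f y * \1_(~` Sigma) x.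
    by apply/funext => x; rewrite k_continuous// [in RHS]mulrC.
  have bS' := bounded_measurableZ (\int[mu]_y f y) bS.
  split; first by rewrite kE; have [] := bounded_measurableD breg bS'.
  under eq_Rintegral do rewrite k_continuous// mulrC.
  rewrite RintegralD//; [|exact: bi|exact: bi].
  rewrite Rintegral_regular_average// RintegralZl//; last exact: bi.
  rewrite Rintegral_indic; last by apply: measurableC; exact: measurable_regular.
  by rewrite [X in fine X](regular_full Smu) mulr0 addr0.
- move=> f g bf bg [mf muf] [mg mug].
  have E : (fun x => \int[k x]_y (f y + g y)) =
      fun x => \int[k x]_y f y + \int[k x]_y g y.
    by apply/funext => x; rewrite RintegralD//; exact: bi.
  split; first by rewrite E; exact: measurable_funD.
  rewrite E [RHS]RintegralD//; [|exact: bi|exact: bi].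
  rewrite RintegralD//; [|by apply: bi; apply: bounded_k|by apply: bi; apply: bounded_k].
  by rewrite muf mug.
- move=> a f bf [mf muf].
  have E : (fun x => \int[k x]_y (a * f y)) = fun x => a * \int[k x]_y f y.
    by apply/funext => x; rewrite RintegralZl//; exact: bi.
  split; first by rewrite E; exact: measurable_funM.
  rewrite E [RHS]RintegralZl//; last exact: bi.
  rewrite RintegralZl//; last by apply: bi; apply: bounded_k.
  by rewrite muf.
- move=> F f M bF FM Ff HF.
  have HF1 n := proj1 (HF n); have HF2 n := proj2 (HF n).
  have cv (P : probability (borel X) R) :
      \int[P]_y F n y @[n --> \oo] --> \int[P]_y f y.
    apply: (@bounded_convergence _ (borel X) _ _ _ _ _ M) => //.
      exact: probability_lty.
    by move=> n; case: (bF n).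
  split.
    apply: (@measurable_fun_cvg _ (borel X) R setT (fun n x => \int[k x]_y F n y)).
      exact: HF1.
    by move=> x _; exact: cv.
  have cv2 : \int[mu]_x \int[k x]_y F n y @[n --> \oo] --> \int[mu]_x \int[k x]_y f y.
    apply: (@bounded_convergence _ (borel X) _ _ _ _ _ M) => //.
    + exact: probability_lty.
    + by move=> n x _; exact: Rintegral_k_bound.
  apply: (cvg_unique (@Rhausdorff R) cv2).
  rewrite (_ : (fun n => _) = fun n => \int[mu]_x F n x); first exact: cv.
  by apply/funext => n; exact: HF2.
Qed.

Lemma bounded_measurable_Rintegral_k f : bounded_measurable (f : borel X -> R) ->
  bounded_measurable (fun x : borel X => \int[k x]_y f y).
Proof.
by move=> bf; apply: bounded_k => //; have [] := disintegration bf.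
Qed.

(** Irregular points belong to no level set, so the product cannot tell them apart; the two clauses
    put them all into one class. *)
Definition class x : set X :=
  [set y | (Sigma x <-> Sigma y) /\
    (Sigma x -> forall f, D f -> time_average S f x = time_average S f y)].

Lemma class_refl x : class x x.
Proof. by []. Qed.

Lemma class_eq x y : class x y -> class x = class y.
Proof.
move=> [xy fxy]; apply/seteqP; split => z [xz fxz]; split.
- exact: iff_trans (iff_sym xy) xz.
- by move=> Sy f Df; have Sx := proj2 xy Sy; rewrite -(fxy Sx f Df) (fxz Sx f Df).
- exact: iff_trans xy xz.
- by move=> Sx f Df; rewrite (fxy Sx f Df) (fxz (proj1 xy Sx) f Df).
Qed.

Lemma measurable_class x : Sigma x -> measurable (class x : set (borel X)).
Proof.
move=> Sx.
rewrite (_ : class x = Sigma `&` \bigcap_(f in D) (reg f @^-1` [set time_average S f x])).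
  apply: measurableI; first exact: measurable_regular.
  apply: countable_bigcap_measurable => // f Df; rewrite -[X in measurable X]setTI.
  by apply: (bounded_measurable_regular_average (D_continuous Df)).1.
apply/seteqP; split => [y [xy fxy]|y [Sy fy]].
  have Sy := proj1 xy Sx.
  by split => // f Df /=; rewrite regular_averageE// fxy.
split; first exact: conj (fun _ => Sy) (fun _ => Sx).
by move=> _ f Df; have /= := fy f Df; rewrite regular_averageE.
Qed.

Lemma class_time_average x y f : Sigma x -> class x y -> continuous f ->
  time_average S f y = time_average S f x.
Proof.
move=> Sx [xy fxy] cf; have Sy := proj1 xy Sx.
apply: (time_average_dense Sy Sx _ cf) => g Dg.
by rewrite (fxy Sx g Dg).
Qed.

(** Makes the later choice of a representative of each atom harmless. Equality is needed on Borel
    sets only. *)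
Lemma class_measure x y (B : set (borel X)) : Sigma x -> class x y -> measurable B ->
  k y B = k x B.
Proof.
move=> Sx xy mB; have Sy := proj1 (proj1 xy) Sx.
apply: probability_unique => // f cf.
by rewrite (k_regular Sx cf) (k_regular Sy cf); exact: class_time_average.
Qed.

Lemma flow_class x t y : class x (S t y) <-> class x y.
Proof.
have tE f : Sigma x -> (Sigma x <-> Sigma y) -> D f ->
    time_average S f (S t y) = time_average S f y.
  move=> Sx xy Df; apply: time_average_flow; first exact: (proj1 xy Sx).
  exact: D_continuous.
have Sty : Sigma (S t y) <-> Sigma y by exact: regular_flow.
split => -[xy fxy].
  have xy' := iff_trans xy Sty.
  by split => // Sx f Df; rewrite (fxy Sx f Df) (tE f Sx xy' Df).
split; first exact: iff_trans xy (iff_sym Sty).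
by move=> Sx f Df; rewrite (fxy Sx f Df) (tE f Sx xy Df).
Qed.

(* The points [x] at which every [f*], [f] in [D], has variance [0] under [k x]. *)
Definition ergodic_points : set X := [set x | Sigma x /\ forall f, D f ->
  \int[k x]_y (reg f y * reg f y) = reg f x * reg f x].
Local Notation G := ergodic_points.

Let breg2 f : D f -> bounded_measurable (fun x : borel X => reg f x * reg f x).
Proof.
move=> Df; apply: bounded_measurableM;
  by apply: bounded_measurable_regular_average; exact: D_continuous.
Qed.

Lemma measurable_ergodic_points : measurable (G : set (borel X)).
Proof.
rewrite (_ : G = Sigma `&` \bigcap_(f in D)
  ((fun x => \int[k x]_y (reg f y * reg f y) - reg f x * reg f x) @^-1` [set 0])).
  apply: measurableI; first exact: measurable_regular.
  apply: countable_bigcap_measurable => // f Df; rewrite -[X in measurable X]setTI.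
  have := bounded_measurableB (bounded_measurable_Rintegral_k (breg2 Df)) (breg2 Df).
  by move=> [+ _]; apply.
apply/seteqP; split => [x [Sx Gx]|x [Sx Gx]]; split => // f Df.
  by rewrite /= Gx// subrr.
by apply/eqP; rewrite -subr_eq0; apply/eqP; exact: Gx.
Qed.

(** Both sides of the equation defining [G] depend on the class alone. Hence [G] is a union of
    classes, as the union of the elements of a partition must be. *)
Lemma class_ergodic_points x y : G x -> class x y -> G y.
Proof.
move=> [Sx Gx] xy; have Sy := proj1 (proj1 xy) Sx.
split => // f Df.
have cf := D_continuous Df.
have -> : \int[k y]_z (reg f z * reg f z) = \int[k x]_z (reg f z * reg f z).
  by congr fine; apply: eq_measure_integral => B mB _; exact: class_measure.
by rewrite (Gx f Df) (regular_averageE f Sx) (regular_averageE f Sy) (class_time_average Sx xy cf).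
Qed.

Let Rintegral_k_reg x f : Sigma x -> continuous f -> \int[k x]_y reg f y = reg f x.
Proof.
move=> Sx cf; rewrite (Rintegral_regular_average (k_preserves Sx))//.
by rewrite k_regular// regular_averageE.
Qed.

(** The value [reg f x] is the mean of [reg f] under [k x]: this measure is invariant, so averaging
    preserves the integral of [f], which is the time average at [x]. *)
Let variance x f : Sigma x -> D f ->
  \int[k x]_y ((reg f y - reg f x) * (reg f y - reg f x)) =
  \int[k x]_y (reg f y * reg f y) - reg f x * reg f x.
Proof.
move=> Sx Df; have cf := D_continuous Df.
have breg : bounded_measurable (reg f : borel X -> R).
  exact: bounded_measurable_regular_average.
set c := reg f x.
transitivity (\int[k x]_y (reg f y * reg f y + ((- 2 * c) * reg f y + c * c))).
  by apply: eq_Rintegral => y _; ring.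
rewrite RintegralD//; [|exact/bi/breg2|]; last first.
  apply: bi; apply: bounded_measurableD; last exact: bounded_measurable_cst.
  exact: bounded_measurableZ.
rewrite RintegralD//; last 2 first.
- by apply: bi; exact: bounded_measurableZ.
- by apply: bi; exact: bounded_measurable_cst.
rewrite RintegralZl//; last exact: bi.
by rewrite Rintegral_cst_probability Rintegral_k_reg// -/c; ring.
Qed.

Let ae_eq0 (P : probability (borel X) R) (h : borel X -> R) : bounded_measurable h ->
  {ae P, forall x, 0 <= h x} -> \int[P]_x h x = 0 -> {ae P, forall x, h x = 0}.
Proof.
move=> bh h0 ih.
have mh : measurable_fun setT (EFin \o h) by apply/measurable_EFinP; case: bh.
have [+ _] := @ae_eq_integral_abs _ _ _ P setT measurableT (EFin \o h) mh.
rewrite (_ : (\int[P]_x `|(EFin \o h) x|)%E = 0%E).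
  by move=> /(_ erefl); apply: ae_impl => x /(_ Logic.I) /= [].
rewrite -[RHS]/(0%:E) -ih EFin_Rintegral//; last exact: bi.
apply: ae_eq_integral => //.
  by apply: measurableT_comp.
by apply: ae_impl h0 => x hx _ /=; rewrite ger0_norm.
Qed.

Lemma ae_ergodic_points : {ae mu, forall x, G x}.
Proof.
have H f : D f -> {ae mu, forall x,
    Sigma x -> \int[k x]_y (reg f y * reg f y) - reg f x * reg f x = 0}.
  move=> Df; apply: (@ae_impl _ (borel X) R mu
    (fun x => \int[k x]_y (reg f y * reg f y) - reg f x * reg f x = 0)) => //.
  apply: ae_eq0.
  - exact: (bounded_measurableB (bounded_measurable_Rintegral_k (breg2 Df)) (breg2 Df)).
  - apply: ae_impl (ae_regular Smu) => x Sx; rewrite -variance//.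
    by apply: Rintegral_ge0 => y _; rewrite -expr2 sqr_ge0.
  - rewrite RintegralB//.
    + by have [_ ->] := disintegration (breg2 Df); rewrite subrr.
    + exact/bi/bounded_measurable_Rintegral_k/breg2.
    + exact/bi/breg2.
apply: ae_impl2 (ae_regular Smu) (ae_countable D_countable H) => x Sx h.
split => // f Df; apply/eqP; rewrite -subr_eq0; apply/eqP; exact: h.
Qed.

(** Zero variance gives one almost sure equality for each [f] in [D], and countability of [D]
    combines them. Almost every point is regular for [k x] because [k x] is itself invariant. *)
Lemma class_full x : G x -> k x (~` class x) = 0%E.
Proof.
move=> [Sx Gx].
have H f : D f -> {ae k x, forall y, reg f y - reg f x = 0}.
  move=> Df; have breg : bounded_measurable (reg f : borel X -> R).
    by apply: bounded_measurable_regular_average; exact: D_continuous.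
  apply: (@ae_impl _ (borel X) R (k x) (fun y => (reg f y - reg f x) * (reg f y - reg f x) = 0)).
    by move=> y /eqP; rewrite mulf_eq0 orbb => /eqP.
  apply: ae_eq0.
  - by apply: bounded_measurableM; apply: bounded_measurableB => //; exact: bounded_measurable_cst.
  - by apply: aeW => y; rewrite -expr2 sqr_ge0.
  - by rewrite variance// Gx// subrr.
have [N [mN PN SN]] : {ae k x, forall y, class x y}.
  apply: ae_impl2 (ae_regular (k_preserves Sx)) (ae_countable D_countable H) => y Sy h.
  split => // _ f Df; have := h f Df.
  by rewrite !regular_averageE// => /eqP; rewrite subr_eq0 => /eqP.
apply: (subset_measure0 _ mN SN PN).
by apply: measurableC; exact: measurable_class.
Qed.

(** As [\1_B] is invariant, [f] may be replaced by its averages under the integral against [\1_B];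
    on [B], which lies in the class of [x], they converge to the constant time average of [f] at
    [x]. *)
Lemma class_ergodic x : G x -> ergodic_on S (class x) (k x).
Proof.
move=> [Sx Gx] B mB Bx SB.
have bB : bounded_measurable (\1_B : borel X -> R) by exact: bounded_measurable_indic.
have inv t y : \1_B (S t y) = \1_B y :> R.
  rewrite !indicE; congr (nat_of_bool _)%:R; apply/idP/idP; rewrite !inE => By.
    rewrite -(SB (- t)); exists (S t y) => //.
    by rewrite -[LHS]/((S (- t) \o S t) y) -SD addNr S0.
  by rewrite -(SB t); exists y.
set p := fine (k x B).
have H f : continuous f -> \int[k x]_y (\1_B y * f y) = p * \int[k x]_y f y.
  move=> cf; have [M _ fM] := continuous_bounded Xc cf.
  rewrite (k_regular Sx cf).
  have bA n : bounded_measurable (fun y : borel X => average S f y n%:R).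
    by apply: continuous_bounded_measurable => //; exact: average_continuous.
  have cv : \int[k x]_y (\1_B y * average S f y n%:R) @[n --> \oo] -->
      \int[k x]_y (\1_B y * time_average S f x).
    apply: (@bounded_convergence _ (borel X) _ _ _ _ _ M) => //.
    - exact: probability_lty.
    - by move=> n; have [] := bounded_measurableM bB (bA n).
    - move=> n y _; rewrite normrM -[leRHS]mul1r ler_pM//; first exact: indic_le1.
      exact: average_bound.
    - move=> y _; rewrite indicE; have [By|nBy] := pselect (B y).
        rewrite mem_set//; apply: cvgM; first exact: cvg_cst.
        rewrite -(class_time_average Sx (Bx y By) cf).
        exact: (time_averageP (proj1 (proj1 (Bx y By)) Sx) cf).
      rewrite memNset// mul0r; apply: cvg_near_cst; apply: nearW => n.
      by rewrite mul0r.
  transitivity (\int[k x]_y (\1_B y * time_average S f x)); last first.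
    rewrite RintegralZr//; last exact: bi.
    by rewrite Rintegral_indic.
  apply/esym/(cvg_unique (@Rhausdorff R) cv).
  apply: cvg_near_cst; exists 1%N => // n /= n0.
  have n1 : 0 < n%:R :> R by rewrite ltr0n.
  transitivity (\int[k x]_y (n%:R^-1 * (\1_B y * I f y n%:R))).
    by apply: eq_Rintegral => y _; rewrite averageE mulrCA.
  rewrite RintegralZl//; last first.
    apply: bi; apply: bounded_measurableM => //.
    by apply: continuous_bounded_measurable => //; exact: time_integral_continuous.
  rewrite (Rintegral_time_integral (k_preserves Sx) bB inv cf (ltW n1)).
  by rewrite mulKf// gt_eqF.
have /(_ _ bB) := @Rintegral_unique R X (k x) (k x) \1_B id p Xc bB (@measurable_id _ _ _) H.
rewrite Rintegral_indic// (@eq_Rintegral _ _ _ _ _ (\1_B : borel X -> R)); last first.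
  by move=> y _; rewrite indicE; case: (_ \in _); rewrite ?mulr1 ?mulr0.
rewrite Rintegral_indic// -/p => pp.
have kB : k x B = p%:E by rewrite fineK// fin_num_measure.
have /eqP : p * (p - 1) = 0 by rewrite mulrBr -pp mulr1 subrr.
rewrite mulf_eq0 subr_eq0 => /orP[] /eqP p01; [left|right]; by rewrite kB p01.
Qed.


(** * The atoms of the product as an ergodic partition *)

Local Notation classes := (atoms (countable_product D (induced_partition S))).

(** With no function in [D] there would be no level set to separate regular points from irregular
    ones. *)
Let D_nonempty : D !=set0.
Proof.
by have [f Df _] := D_dense.2 _ (@continuous_cstf R X 0) 1 ltr01; exists f.
Qed.

Lemma atomE x :
  [set y | forall B, countable_product D (induced_partition S) B -> (B x <-> B y)] = class x.
Proof.
apply/seteqP; split => y xy.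
  have gen f : D f -> forall a, Sigma x /\ time_average S f x = a <->
      Sigma y /\ time_average S f y = a.
    move=> Df a; apply: (xy [set z | Sigma z /\ time_average S f z = a]).
    by apply: sub_gen_smallest; exists f => //; exists a.
  have [f0 Df0] := D_nonempty; split; first split => [Sx|Sy].
  - exact: proj1 (proj1 (gen f0 Df0 _) (conj Sx erefl)).
  - exact: proj1 (proj2 (gen f0 Df0 _) (conj Sy erefl)).
  by move=> Sx f Df; have [_ ->] := proj1 (gen f Df _) (conj Sx erefl).
(* The sets that do not separate [x] from [y] form a sigma-algebra, so it is enough to test the
   level sets. *)
move=> /=; apply: smallest_sub.
  split=> [//|A xAy|A xAy].
    by split=> -[_ nA]; split=> // Az; apply: nA; apply/xAy.
  by split=> -[n _ An]; exists n => //; apply/xAy.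
move=> _ [f Df [a _ <-]] /=; have [xSy fxy] := xy; split => -[Sz <-].
  by split; [exact: proj1 xSy Sz|rewrite (fxy Sz f Df)].
by split; [exact: proj2 xSy Sz|rewrite (fxy (proj2 xSy Sz) f Df)].
Qed.

Lemma class_invariant x : Defs.invariant S (class x).
Proof.
move=> t; apply/seteqP; split => [_ [y xy <-]|y xy].
  exact: (proj2 (flow_class x t y) xy).
exists (S (- t) y); first exact: (proj2 (flow_class x (- t) y) xy).
by rewrite -[LHS]/((S t \o S (- t)) y) -SD subrr S0.
Qed.

(** The set [U] allows two uses: all atoms, with [U] the whole space, and the atoms of ergodic
    points, with [U = G]. *)
Lemma measurable_partition_classes (zeta : set (set X)) (U : set (borel X)) :
  (forall A, zeta A -> exists x, A = class x) -> \bigcup_(A in zeta) A = U ->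
  measurable U -> mu (~` U) = 0%E -> measurable_partition mu zeta.
Proof.
move=> zc zU mU muU.
have zE A x : zeta A -> A x -> A = class x.
  by move=> /zc[y ->] yx; exact: class_eq.
split.
  split.
    move=> A B zA zB AB; rewrite (_ : A `&` B = set0); first exact: negligible_set0.
    rewrite -subset0 => x [Ax Bx]; apply: AB.
    by rewrite (zE A x)// (zE B x).
  by rewrite zU; exists (~` U); split => //; exact: measurableC.
have [e De eD] := countable_enum D_nonempty D_countable.
(* Rational sublevel sets of the time averages on regular points, with [None] for the set of regular
   points itself. The boolean adds complements, because the first of two given elements must be the
   one inside the separating set. *)
pose base (p : option (nat * rat) * bool) : set X :=
  let B := if p.1 is Some (n, q) then Sigma `&` [set x | reg (e n) x < ratr q]
           else Sigma in
  if p.2 then B else ~` B.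
have mbase p : measurable (base p : set (borel X)).
  have mB : measurable ((if p.1 is Some (n, q) then
      Sigma `&` [set x | reg (e n) x < ratr q] else Sigma) : set (borel X)).
    case: p.1 => [[n q]|]; last exact: measurable_regular.
    apply: measurableI; first exact: measurable_regular.
    have [mreg _] := bounded_measurable_regular_average (D_continuous (De n)).
    rewrite (_ : mkset _ = [set x | - ratr q < -1 * reg (e n) x]).
      by apply: (@measurable_gt _ (borel X)); exact: measurable_funM.
    by apply/seteqP; split => x /=; rewrite mulN1r ltrN2.
  by rewrite /base; case: p.2 => //; exact: measurableC.
have sat p x y : class x y -> base p x -> base p y.
  move=> xy; have regxy f : D f -> reg f x = reg f y.
    move=> Df; rewrite /regular_average !indicE.
    have [Sx|nSx] := pselect (Sigma x).
      have Sy := proj1 (proj1 xy) Sx.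
      by rewrite (mem_set Sx) (mem_set Sy) (proj2 xy Sx f Df).
    have nSy : ~ Sigma y := fun Sy => nSx (proj2 (proj1 xy) Sy).
    by rewrite (memNset nSx) (memNset nSy) !mul0r.
  case: p => -[[n q]|] [] /=; rewrite /base/=.
  - by move=> [/(proj1 (proj1 xy)) Sy rx]; split => //=; rewrite -regxy.
  - move=> nx [Sy ry]; apply: nx; split; first exact: (proj2 (proj1 xy) Sy).
    by rewrite /= regxy.
  - exact: proj1 (proj1 xy).
  - by move=> nx Sy; apply: nx; exact: (proj2 (proj1 xy) Sy).
have sep x y : class x <> class y -> exists p, base p x /\ ~ base p y.
  move=> nxy; have [Sx|nSx] := pselect (Sigma x); have [Sy|nSy] := pselect (Sigma y).
  - have [f [Df fxy]] : exists f, D f /\ time_average S f x <> time_average S f y.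
      apply: contrapT => /forallNP nf; apply: nxy; apply: class_eq; split => // _ f Df.
      by apply: contrapT => fxy; exact: (nf f).
    have [n fE] := eD f Df; rewrite -fE in fxy.
    have rx := @regular_averageE (e n) x Sx; have ry := @regular_averageE (e n) y Sy.
    move/eqP: fxy; rewrite neq_lt -rx -ry => /orP[] /rat_in_itvoo[q];
      rewrite in_itv/= => /andP[q1 q2].
      exists (Some (n, q), true); split; first by split.
      by move=> [_] /=; rewrite ltNge (ltW q2).
    exists (Some (n, q), false); split; last by apply; split.
    by move=> [_] /=; rewrite ltNge (ltW q2).
  - exists (None, true); exact: conj Sx nSy.
  - exists (None, false); exact: conj nSx (fun h => h Sy).
  - case: nxy; apply: class_eq; split; last exact: (fun Sx => False_ind _ (nSx Sx)).
    exact: conj (fun Sx => False_ind _ (nSx Sx)) (fun Sy => False_ind _ (nSy Sy)).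
exists (range (fun p => U `&` base p)); split.
- exact: (sub_countable (card_image_le _ _) (countableP _)).
- by move=> _ [p _ <-]; exact: measurableI.
- move=> _ [p _ <-]; exists [set A | zeta A /\ A `<=` base p]; first by move=> A [].
  apply/seteqP; split => [x [Ux px]|x [A [zA Ap] Ax]]; last first.
    by split; [rewrite -zU; exists A|exact: Ap].
  move: Ux; rewrite -zU => -[A zA Ax]; exists A => //; split => //.
  by rewrite (zE A x)// => y xy; exact: sat px.
- move=> A B zA zB AB; have [x Ax] := zc A zA; have [y By] := zc B zB.
  rewrite Ax By in AB; have [p [px py]] := sep x y AB.
  exists (U `&` base p); split; first by exists p.
    move=> z Az; split; first by rewrite -zU; exists A.
    by apply: sat px; rewrite Ax in Az.
  move=> z Bz [_ pz]; apply: py; apply: sat pz.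
  by rewrite By in Bz; rewrite -(class_eq Bz); exact: class_refl.
Qed.

Lemma integral_full (P : probability (borel X) R) (A : set (borel X)) (f : borel X -> \bar R) :
  measurable A -> P (~` A) = 0%E -> measurable_fun setT f ->
  (\int[P]_(x in A) f x = \int[P]_x f x)%E.
Proof.
move=> mA PA mf; have mAc : measurable (~` A) by exact: measurableC.
have AE : A = setT `\` ~` A by rewrite setTD setCK.
rewrite integralE [RHS]integralE {1 2}AE.
rewrite -!(ge0_negligible_integral mAc measurableT)//.
- exact: measurable_funeneg.
- exact: measurable_funepos.
Qed.

Theorem ergodic_partition_classes : ergodic_partition_mod0 mu S classes.
Proof.
have classesE A : classes A -> exists x, A = class x.
  by move=> [x _ <-]; exists x; rewrite atomE.
have muG : mu (~` G) = 0%E.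
  have [N [mN PN SN]] := ae_ergodic_points.
  by apply: (subset_measure0 _ mN SN PN); apply: measurableC; exact: measurable_ergodic_points.
split.
- apply: (@measurable_partition_classes _ setT) => //.
    apply/seteqP; split => // x _; exists (class x); last exact: class_refl.
    by exists x => //; rewrite atomE.
  by rewrite setCT measure0.
- by move=> A /classesE[x ->]; exact: class_invariant.
(* Outside [G] an atom need not have full measure for its [k x]; these atoms have negligible union
   and are left out. *)
exists [set A | exists2 x, G x & A = class x].
  by move=> _ [x _ ->]; exists x => //; rewrite atomE.
set zeta := mkset _.
have elementE x : G x -> element zeta x = class x.
  move=> Gx; apply: xget_unique; first by split; [exists x|exact: class_refl].
  by move=> _ [[y Gy ->] yx]; exact: class_eq.
have element0 x : ~ G x -> element zeta x = set0.
  move=> nGx; apply: xgetPN => _ [[y Gy ->] yx]; apply: nGx.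
  exact: class_ergodic_points yx.
(* The measures must be indexed by sets, while [k] is indexed by points. *)
pose rep (A : set X) := xget (point : X) A.
have repP x : class x (rep (class x)).
  by apply: xgetPex; exists x; exact: class_refl.
have rep_k x B : G x -> measurable B -> k (rep (class x)) B = k x B.
  by move=> [Sx _] mB; exact: class_measure.
split.
- apply: (@measurable_partition_classes _ G) => //.
  + by move=> A [x _ ->]; exists x.
  + apply/seteqP; split => [x [_ [y Gy ->] yx]|x Gx].
      exact: class_ergodic_points yx.
    by exists (class x); [exists x|exact: class_refl].
  + exact: measurable_ergodic_points.
- by move=> A [x _ ->]; exact: class_invariant.
exists (fun A => k (rep A)); split.
  move=> _ [x Gx ->].
  have Gr : G (rep (class x)) by exact: class_ergodic_points (repP x).
  have mx : measurable (class x : set (borel X)) by apply: measurable_class; case: Gx.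
  split => //.
  - rewrite rep_k//.
    rewrite -(probability_setT (k x)) -(setvU (class x)) measureU ?setICl//.
      by rewrite [X in (_ = X + _)%E](class_full Gx) add0e.
    exact: measurableC.
  - by apply: k_preserves; case: Gr.
  - by have := class_ergodic Gr; rewrite -(class_eq (repP x)).
move=> f fi inner.
have mf : measurable_fun setT (EFin \o f) by case/integrableP : fi.
have mk (B : set (borel X)) : measurable B -> measurable_fun setT (fun x : borel X => k x B).
  move=> mB; have [mkB _] := disintegration (bounded_measurable_indic mB).
  rewrite (_ : (fun x => _) = fun x => (\int[k x]_y \1_B y)%:E); first exact/measurable_EFinP.
  by apply/funext => x; rewrite Rintegral_indic// fineK// fin_num_measure.
have muk (B : set (borel X)) : measurable B -> mu B = (\int[mu]_x k x B)%E.
  move=> mB; have bB : bounded_measurable (\1_B : borel X -> R) by exact: bounded_measurable_indic.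
  have [_ kB] := disintegration bB.
  rewrite Rintegral_indic// in kB.
  rewrite -(fineK (fin_num_measure mu _ mB)) -kB EFin_Rintegral//; last first.
    by apply: bi; exact: bounded_measurable_Rintegral_k.
  by apply: eq_integral => x _; rewrite Rintegral_indic// fineK// fin_num_measure.
have [H1 H2 H3] := integrable_disintegration mk muk fi.
have elE x : G x -> inner x = (\int[k x]_y (f y)%:E)%E.
  move=> Gx; rewrite /inner elementE//.
  rewrite (@eq_measure_integral _ _ _ _ (k x)); last by move=> A mA _; exact: rep_k.
  apply: integral_full => //; last exact: class_full.
  by apply: measurable_class; case: Gx.
(* Off [G] the element containing [x] is [set0] by convention, so [inner] vanishes there; as [G] has
   full measure, the integral is unaffected. *)
have innerE : inner = (fun x => \int[k x]_y (f y)%:E)%E \_ G.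
  apply/funext => x; rewrite patchE; case: ifPn => [|/negP]; rewrite inE => Gx.
    exact: elE.
  by rewrite /inner element0// integral_set0.
have mG := measurable_ergodic_points.
split.
- apply: ae_impl2 ae_ergodic_points H1 => x Gx kf.
  rewrite elementE//; have mx : measurable (class x : set (borel X)).
    by apply: measurable_class; case: Gx.
  have /integrableP[_ kfx] := integrableS measurableT mx (@subsetT _ _) kf.
  apply/integrableP; split; first exact: measurable_funTS.
  rewrite (@eq_measure_integral _ _ _ _ (k x))// => A mA _; exact: rep_k.
- rewrite innerE; apply/(integrable_mkcond _ mG).
  exact: (integrableS measurableT mG (@subsetT _ _) H2).
- rewrite H3 innerE -integral_mkcond; apply/esym.
  by apply: integral_full => //; case/integrableP : H2.
Qed.

End Decomposition.

End Dense.

End TimeAverages.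

Theorem theorem6 (R : realType) (X : pmetricType R)
    (X_compact : compact [set: X])
    (mu : probability (borel X) R)
    (C : set (X -> R)) (C_smooth : smooth_structure C)
    (F : forall x : X, tangent C x)
    (S : R -> X -> X)
    (S_flow : measure_preserving_flow C mu S)
    (S_F : generated_by S F)
    (D : set (X -> R)) (D_countable : countable D)
    (D_dense : dense_in_continuous D) :
  ergodic_partition_mod0 mu S
    (atoms (countable_product D (induced_partition S))).
Proof.
have Sc t : continuous (S t) by exact: (flow_continuous X_compact C_smooth S_flow).
have So x : continuous (fun t => S t x).
  exact: (orbit_continuous X_compact C_smooth S_flow S_F).
have S0 := flow0 S_flow; have SD := flowD S_flow.
have [k [k_regular k_irregular]] := time_average_measures X_compact SD So mu.
exact: (ergodic_partition_classes X_compact S0 SD Sc So D_countable D_dense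
  (flow_preserves S_flow) k_regular k_irregular).
Qed.
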